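(* The set $$\mathrm{SpGr}(2n,2k):=\{P\in\mathbb{R}^{2n\times2n}\mid P^2=P,\ \mathrm{rank}(P)=2k,\ P^+=P\}$$ consists of the symplectic projections onto the $2k$-dimensional symplectic subspaces of the standard symplectic space $(\mathbb{R}^{2n},\omega_0)$. It has a smooth manifold structure (and is called the real symplectic Grassmann manifold). It features the quotient representation $$\mathrm{SpGr}(2n,2k)\cong\mathrm{Sp}(2n,\mathbb{R})/\big(\mathrm{Sp}(2k,\mathbb{R})\times\mathrm{Sp}(2(n-k),\mathbb{R})\big)$$ (diffeomorphism) and has dimension $\dim\mathrm{SpGr}(2n,2k)=4(n-k)k$.
   Context: Let $k\le n$ be positive integers, $J_{2m}=\begin{bmatrix}0&I_m\\-I_m&0\end{bmatrix}$, $\omega_0(x,y)=x^TJ_{2n}y$ on $\mathbb{R}^{2n}$, and for a real $2a\times 2b$ matrix $A$ put $A^+:=J_{2b}^TA^TJ_{2a}$. $\mathrm{Sp}(2n,\mathbb{R})=\{M\in\mathbb{R}^{2n\times 2n}: M^+M=I_{2n}\}$. A subspace $\mathcal U\subset\mathbb{R}^{2n}$ is symplectic if $\mathcal U\cap\mathcal U^{\perp}=\{0\}$, where $\mathcal U^\perp=\{v:\omega_0(v,u)=0\ \forall u\in\mathcal U\}$ is its symplectic complement; the symplectic projection onto it is the projection with range $\mathcal U$ and kernel $\mathcal U^\perp$. The product $\mathrm{Sp}(2k,\mathbb{R})\times\mathrm{Sp}(2(n-k),\mathbb{R})$ is regarded as the subgroup of $\mathrm{Sp}(2n,\mathbb{R})$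 consisting of the matrices $$\begin{bmatrix}A_1&0&B_1&0\\0&A_2&0&B_2\\C_1&0&D_1&0\\0&C_2&0&D_2\end{bmatrix}$$ with $\begin{bmatrix}A_1&B_1\\C_1&D_1\end{bmatrix}\in\mathrm{Sp}(2k,\mathbb{R})$ and $\begin{bmatrix}A_2&B_2\\C_2&D_2\end{bmatrix}\in\mathrm{Sp}(2(n-k),\mathbb{R})$. The manifold structure on $\mathrm{SpGr}(2n,2k)$ is the one for which the action $(M,X)\mapsto MXM^+$ of $\mathrm{Sp}(2n,\mathbb{R})$ is smooth. *)

(* Defs.v *)
From HB Require Import structures.
From mathcomp Require Import all_boot all_order all_algebra.
From mathcomp Require Import all_classical all_reals all_analysis.

Set Implicit Arguments.
Unset Strict Implicit.
Unset Printing Implicit Defensive.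

Import Order.TTheory GRing.Theory Num.Theory.
Import numFieldNormedType.Exports.

Local Open Scope classical_set_scope.
Local Open Scope quotient_scope.
Local Open Scope ring_scope.

Section SmoothOn.
Variables (R : realType) (V W : normedModType R).

(* On an open subset of a finite-dimensional space, f is C^(m+1) iff it is
   differentiable with all its directional derivatives of class C^m. *)
Fixpoint Ck_on (m : nat) (U : set V) (f : V -> W) : Prop :=
  match m with
  | 0 => forall x, U x -> {for x, continuous f}
  | m'.+1 => (forall x, U x -> differentiable f x) /\
             forall v, Ck_on m' U (fun x => 'D_v f x)
  end.

Definition smooth_on (U : set V) (f : V -> W) := forall m, Ck_on m U f.

End SmoothOn.

(* chart_fun and chart_inv are total; only their restrictions to chart_dom and
   chart_codom matter. *)
Record chart (R : realType) (X : topologicalType) (d : nat) := Chart {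
  chart_dom : set X;
  chart_fun : X -> 'rV[R]_d;
  chart_inv : 'rV[R]_d -> X }.

Definition chart_codom (R : realType) (X : topologicalType) d
  (c : chart R X d) : set 'rV[R]_d := chart_fun c @` chart_dom c.

Definition is_chart (R : realType) (X : topologicalType) d
    (c : chart R X d) : Prop :=
  [/\ open (chart_dom c), open (chart_codom c),
      (forall x, chart_dom c x -> chart_inv c (chart_fun c x) = x),
      {within chart_dom c, continuous (chart_fun c)} &
      {within chart_codom c, continuous (chart_inv c)}].

Section SmoothMaps.
Variables (R : realType) (X Y : topologicalType) (d e : nat).

(* The expression of f : X -> Y in the charts c and c', and its domain. *)
Definition local_rep (c : chart R X d) (c' : chart R Y e) (f : X -> Y) :
    'rV[R]_d -> 'rV[R]_e :=
  chart_fun c' \o f \o chart_inv c.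

Definition local_dom (c : chart R X d) (c' : chart R Y e) (f : X -> Y) :
    set 'rV[R]_d :=
  chart_fun c @` (chart_dom c `&` f @^-1` chart_dom c').

Variables (A : set (chart R X d)) (B : set (chart R Y e)).

Definition smooth_map (f : X -> Y) : Prop :=
  continuous f /\
  forall c c', A c -> B c' -> smooth_on (local_dom c c' f) (local_rep c c' f).

Definition smooth_submersion (f : X -> Y) : Prop :=
  smooth_map f /\
  forall c c', A c -> B c' -> forall x, local_dom c c' f x ->
  forall w : 'rV[R]_e, exists v : 'rV[R]_d, 'd (local_rep c c' f) x v = w.

End SmoothMaps.

Definition smooth_atlas (R : realType) (X : topologicalType) d
    (A : set (chart R X d)) : Prop :=
  [/\ (forall c, A c -> is_chart c),
      (forall x, exists2 c, A c & chart_dom c x) &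
      (forall c c', A c -> A c' ->
         smooth_on (local_dom c c' id) (local_rep c c' id))].

(* A is the atlas of a d-dimensional smooth manifold structure on the
   topological space X. *)
Definition smooth_manifold (R : realType) (X : topologicalType) d
    (A : set (chart R X d)) : Prop :=
  [/\ hausdorff_space X, @second_countable X & smooth_atlas A].

Definition diffeomorphism (R : realType) (X Y : topologicalType) d e
    (A : set (chart R X d)) (B : set (chart R Y e)) (f : X -> Y) : Prop :=
  smooth_map A B f /\
  exists g : Y -> X, [/\ cancel f g, cancel g f & smooth_map B A g].

Definition prod_chart (R : realType) (X Y : topologicalType) d e
    (c : chart R X d) (c' : chart R Y e) : chart R (X * Y)%type (d + e) :=
  Chart (chart_dom c `*` chart_dom c')
        (fun p => row_mx (chart_fun c p.1) (chart_fun c' p.2))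
        (fun v => (chart_inv c (lsubmx v), chart_inv c' (rsubmx v))).

Definition prod_atlas (R : realType) (X Y : topologicalType) d e
    (A : set (chart R X d)) (B : set (chart R Y e)) :
    set (chart R (X * Y)%type (d + e)) :=
  [set cc | exists c c', [/\ A c, B c' & cc = prod_chart c c']].

(* The subset S of V, with its subspace topology, is an embedded submanifold
   with atlas A: the inclusion of S into V is a smooth immersion (it is a
   topological embedding by definition of the topology of the type S). *)
Definition embedded_submanifold (R : realType) (V : normedModType R)
    (S : set V) d (A : set (chart R S d)) : Prop :=
  smooth_manifold A /\
  forall c, A c ->
    smooth_on (chart_codom c) (fun v => set_val (chart_inv c v)) /\
    forall x, chart_codom c x ->
      injective ('d (fun v => set_val (chart_inv c v)) x).

Section Symplectic.
Variable R : realType.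

Definition J (m : nat) : 'M[R]_(m + m) := block_mx 0 1%:M (- 1%:M) 0.

Definition sadj (a b : nat) (A : 'M[R]_(a + a, b + b)) : 'M[R]_(b + b, a + a) :=
  (J b)^T *m A^T *m J a.

Definition Sp (n : nat) : set 'M[R]_(n + n) := [set M | sadj M *m M = 1%:M].

Definition omega0 n (x y : 'cV[R]_(n + n)) : R := (x^T *m J n *m y) 0 0.

Definition sympl_compl n (U : {vspace 'cV[R]_(n + n)}) : set 'cV[R]_(n + n) :=
  [set v | forall u, u \in U -> omega0 v u = 0].

Definition symplectic_subspace n (U : {vspace 'cV[R]_(n + n)}) : Prop :=
  [set` U] `&` sympl_compl U = [set 0].

(* P is the projection with range U and kernel the symplectic complement of U. *)
Definition symplectic_projection n (U : {vspace 'cV[R]_(n + n)})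
    (P : 'M[R]_(n + n)) : Prop :=
  [/\ P *m P = P,
      range (fun x : 'cV[R]_(n + n) => P *m x) = [set` U] &
      [set x : 'cV[R]_(n + n) | P *m x = 0] = sympl_compl U].

Definition SpGr (n k : nat) : set 'M[R]_(n + n) :=
  [set P | [/\ P *m P = P, \rank P = (2 * k)%N & sadj P = P]].

Lemma JtrE m : (J m)^T = - J m.
Proof.
by rewrite /J tr_block_mx opp_block_mx !trmx0 trmx1 linearN /= trmx1 !oppr0 opprK.
Qed.

Lemma JJ m : J m *m J m = - 1%:M.
Proof.
rewrite /J mulmx_block !mul0mx !mulmx0 !mulmx1 mul1mx !add0r !addr0.
by rewrite [RHS](_ : _ = - block_mx 1%:M 0 0 1%:M) ?scalar_mx_block //
           opp_block_mx !oppr0.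
Qed.

Lemma JtrJ m : (J m)^T *m J m = 1%:M.
Proof. by rewrite JtrE mulNmx JJ opprK. Qed.

Lemma JJtr m : J m *m (J m)^T = 1%:M.
Proof. by rewrite JtrE mulmxN JJ opprK. Qed.

Lemma sadjM a b c (A : 'M[R]_(a + a, b + b)) (B : 'M[R]_(b + b, c + c)) :
  sadj (A *m B) = sadj B *m sadj A.
Proof.
rewrite /sadj trmx_mul !mulmxA; congr (_ *m _ *m _).
by rewrite -(mulmxA _ (J b)) JJtr mulmx1.
Qed.

Lemma sadjK a b (A : 'M[R]_(a + a, b + b)) : sadj (sadj A) = A.
Proof.
rewrite /sadj !trmx_mul !trmxK JtrE !(mulNmx, mulmxN) opprK mulmxA JJ.
by rewrite -!mulmxA JJ mulNmx !mulmxN mulmx1 mul1mx opprK.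
Qed.

Lemma sadj1 n : sadj (1%:M : 'M[R]_(n + n)) = 1%:M.
Proof. by rewrite /sadj trmx1 mulmx1 JtrJ. Qed.

Lemma Sp_mulr n (M : 'M[R]_(n + n)) : Sp M -> M *m sadj M = 1%:M.
Proof. exact: mulmx1C. Qed.

Lemma Sp1 n : Sp (1%:M : 'M[R]_(n + n)).
Proof. by rewrite /Sp /= sadj1 mulmx1. Qed.

Lemma SpM n (M N : 'M[R]_(n + n)) : Sp M -> Sp N -> Sp (M *m N).
Proof.
rewrite /Sp /= => MS NS.
by rewrite sadjM mulmxA -(mulmxA _ _ M) MS mulmx1.
Qed.

Lemma Sp_sadj n (M : 'M[R]_(n + n)) : Sp M -> Sp (sadj M).
Proof. by move=> MS; rewrite /Sp /= sadjK Sp_mulr. Qed.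

Lemma SpGr_act n k (M P : 'M[R]_(n + n)) :
  Sp M -> SpGr k P -> SpGr k (M *m P *m sadj M).
Proof.
move=> MS [PP rP sP]; have M1 : sadj M *m M = 1%:M := MS; split.
- move: (sadj M) M1 => N NM1.
  by rewrite !mulmxA -(mulmxA _ N) NM1 mulmx1 -(mulmxA M P P) PP.
- have [Mu Mu'] := mulmx1_unit M1.
  by rewrite mxrankMfree ?row_free_unit// -mxrank_tr trmx_mul mxrankMfree
             ?row_free_unit ?unitmx_tr// mxrank_tr.
- by rewrite sadjM sadjK sadjM sP mulmxA.
Qed.

Definition sp_action n k (p : Sp (n:=n) * SpGr (n:=n) k) : SpGr (n:=n) k :=
  exist _ (set_val p.1 *m set_val p.2 *m sadj (set_val p.1))
    (mem_set (SpGr_act (set_valP p.1) (set_valP p.2))).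

(* The symplectic direct sum: the halves of the two factors are interleaved. *)
Definition sp_dsum k l (A : 'M[R]_(k + k)) (B : 'M[R]_(l + l)) :
    'M[R]_((k + l) + (k + l)) :=
  block_mx (block_mx (ulsubmx A) 0 0 (ulsubmx B))
           (block_mx (ursubmx A) 0 0 (ursubmx B))
           (block_mx (dlsubmx A) 0 0 (dlsubmx B))
           (block_mx (drsubmx A) 0 0 (drsubmx B)).

Section Quotient.
Variables (k l n : nat) (e : (k + l)%N = n).

Definition cast2 (M : 'M[R]_((k + l) + (k + l))) : 'M[R]_(n + n) :=
  castmx (f_equal2 addn e e, f_equal2 addn e e) M.

Definition SpProd : set 'M[R]_(n + n) :=
  [set M | exists A B, [/\ Sp A, Sp B & M = cast2 (@sp_dsum k l A B)]].

(* The projection onto the span of e_1, ..., e_k, e_(n+1), ..., e_(n+k);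
   SpProd is its stabilizer. *)
Definition SpGr_base : 'M[R]_(n + n) := cast2 (@sp_dsum k l 1%:M 0).

Lemma block_mxP m (A : 'M[R]_(m + m)) : exists a b c d, A = block_mx a b c d.
Proof.
by exists (ulsubmx A), (ursubmx A), (dlsubmx A), (drsubmx A); rewrite submxK.
Qed.

Lemma sp_dsum_block (a b c d : 'M[R]_k) (a' b' c' d' : 'M[R]_l) :
  sp_dsum (block_mx a b c d) (block_mx a' b' c' d') =
  block_mx (block_mx a 0 0 a') (block_mx b 0 0 b')
           (block_mx c 0 0 c') (block_mx d 0 0 d').
Proof. by rewrite /sp_dsum !(block_mxKul, block_mxKur, block_mxKdl, block_mxKdr). Qed.

Lemma sp_dsumM (A A' : 'M[R]_(k + k)) (B B' : 'M[R]_(l + l)) :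
  sp_dsum A B *m sp_dsum A' B' = sp_dsum (A *m A') (B *m B').
Proof.
have [? [? [? [? ->]]]] := block_mxP A; have [? [? [? [? ->]]]] := block_mxP B.
have [? [? [? [? ->]]]] := block_mxP A'; have [? [? [? [? ->]]]] := block_mxP B'.
rewrite [block_mx _ _ _ _ *m block_mx _ _ _ _ in X in _ = sp_dsum X _]mulmx_block.
rewrite [block_mx _ _ _ _ *m block_mx _ _ _ _ in X in _ = sp_dsum _ X]mulmx_block.
rewrite !sp_dsum_block !mulmx_block.
by rewrite !add_block_mx !(mul0mx, mulmx0, addr0, add0r).
Qed.

Lemma sp_dsum1 : sp_dsum (1%:M : 'M[R]_(k + k)) (1%:M : 'M[R]_(l + l)) = 1%:M.
Proof.
rewrite (scalar_mx_block k k) (scalar_mx_block l l) sp_dsum_block.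
rewrite [RHS](scalar_mx_block (k + l) (k + l)) (scalar_mx_block k l).
by rewrite block_mx0.
Qed.

Lemma sadj_block m (A B C D : 'M[R]_m) :
  sadj (block_mx A B C D) = block_mx D^T (- B^T) (- C^T) A^T.
Proof.
rewrite /sadj JtrE tr_block_mx /J opp_block_mx !mulmx_block.
by rewrite !(oppr0, opprK, mul0mx, mulmx0, mul1mx, mulmx1, mulNmx, mulmxN,
             addr0, add0r, oppr0, opprK).
Qed.

Lemma sadj_dsum (A : 'M[R]_(k + k)) (B : 'M[R]_(l + l)) :
  sadj (sp_dsum A B) = sp_dsum (sadj A) (sadj B).
Proof.
have [? [? [? [? ->]]]] := block_mxP A; have [? [? [? [? ->]]]] := block_mxP B.
rewrite sp_dsum_block !sadj_block sp_dsum_block.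
by rewrite !tr_block_mx !opp_block_mx !trmx0 !oppr0.
Qed.

End Quotient.

Lemma SpProd1 k l n (e : (k + l)%N = n) : SpProd e 1%:M.
Proof.
by case: n / e; exists 1%:M, 1%:M; rewrite sp_dsum1 /cast2 castmx_id;
  split => //; exact: Sp1.
Qed.

Lemma SpProdM k l n (e : (k + l)%N = n) M N :
  SpProd e M -> SpProd e N -> SpProd e (M *m N).
Proof.
case: n / e M N => _ _ [A [B [SA SB ->]]] [A' [B' [SA' SB' ->]]].
exists (A *m A'), (B *m B'); rewrite -sp_dsumM /cast2 !castmx_id.
by split => //; exact: SpM.
Qed.

Lemma SpProd_sadj k l n (e : (k + l)%N = n) M :
  SpProd e M -> SpProd e (sadj M).
Proof.
case: n / e M => _ [A [B [SA SB ->]]].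
exists (sadj A), (sadj B); rewrite -sadj_dsum /cast2 !castmx_id.
by split => //; exact: Sp_sadj.
Qed.

(* M and N lie in the same left coset of SpProd; recall sadj M = M^-1. *)
Definition sp_coset_rel k l n (e : (k + l)%N = n) : rel (Sp (n:=n)) :=
  fun M N => `[< SpProd e (sadj (set_val M) *m set_val N) >].

Lemma sp_coset_refl k l n (e : (k + l)%N = n) : reflexive (sp_coset_rel e).
Proof.
move=> M; apply/asboolP; have -> : sadj (set_val M) *m set_val M = 1%:M.
  exact: (set_valP M).
exact: SpProd1.
Qed.

Lemma sp_coset_sym k l n (e : (k + l)%N = n) : symmetric (sp_coset_rel e).
Proof.
move=> M N; apply/asboolP/asboolP => /SpProd_sadj.
  by rewrite sadjM sadjK.
by rewrite sadjM sadjK.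
Qed.

Lemma sp_coset_trans k l n (e : (k + l)%N = n) : transitive (sp_coset_rel e).
Proof.
move=> N M P /asboolP MN /asboolP NP; apply/asboolP.
have := SpProdM MN NP.
by rewrite mulmxA -(mulmxA (sadj _) (set_val N)) (Sp_mulr (set_valP N)) mulmx1.
Qed.

Definition sp_coset_equiv k l n (e : (k + l)%N = n) : equiv_rel (Sp (n:=n)) :=
  EquivRel (sp_coset_rel e) (sp_coset_refl e) (sp_coset_sym e)
    (@sp_coset_trans _ _ _ e).

Definition SpQuot k l n (e : (k + l)%N = n) : topologicalType :=
  quotient_topology {eq_quot (sp_coset_equiv e)}.

Definition SpQuot_pi k l n (e : (k + l)%N = n) : Sp (n:=n) -> SpQuot e :=
  \pi_(quotient_topology {eq_quot (sp_coset_equiv e)}).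

End Symplectic.

Arguments Sp R n : clear implicits.
Arguments SpGr R n k : clear implicits.
Arguments SpGr_base R {k l n} e.
Arguments SpQuot R {k l n} e.
Arguments SpQuot_pi R {k l n} e.

(* Main.v *)
Require Import Defs.
From HB Require Import structures.
From mathcomp Require Import all_boot all_order all_algebra.
From mathcomp Require Import all_classical all_reals all_analysis.
From mathcomp Require Import ring lra zify.

(** A symplectic projection is determined by its range, so SpGr(2n,2k) is the
    open part of the Grassmannian of 2k-planes cut out by nondegeneracy of
    omega_0, and near a given point a 2k-plane is the graph of a linear map from
    a reference plane to its complement.  This gives 2k * 2(n-k) coordinates.

    Everything is made explicit with rational maps.  Let E and F be the
    inclusions of the two symplectic summands R^2k and R^2(n-k) of R^2n, so that
    E^+ E = 1, F^+ F = 1, E^+ F = 0 and the base projection is E E^+.  For a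
    2(n-k) x 2k matrix A the graph W = E + F A satisfies W^+ W = 1 + A^+ A, and
    when this Gram matrix is invertible W (W^+ W)^-1 W^+ is the symplectic
    projection onto its column space.  Conversely a projection Q whose corner
    E^+ Q E is invertible has slope A = F^+ Q E (E^+ Q E)^-1.  Translating by
    g in Sp(2n) gives charts around every point of the orbit of the base
    projection (gr_chart_ambient).  Likewise the Cayley transform
    X |-> M (1 - X)(1 + X)^-1 on Hamiltonian matrices X^+ = -X parametrizes
    Sp(2n) near M, and it is an involution (sp_chart_ambient).  In both cases
    the chart and its inverse are restrictions of smooth maps between open sets
    of matrix spaces, so that transition maps, and the local expressions of the
    action, are smooth as composites of such maps (induced_atlas,
    induced_local_rep_smooth).

    The orbit map M |-> M (E E^+) M^+ is onto: a symplectic basis of the range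
    of a self-adjoint idempotent P is built one hyperbolic pair at a time, the
    partner of a unit vector u of the range being v = P J^T u, because then
    omega_0(u, v) = |u|^2.  Its fibres are the cosets of the stabilizer
    Sp(2k) x Sp(2(n-k)), whence a continuous bijection from the quotient onto
    SpGr.  The vectors chosen above are bounded in terms of |P|, so every
    bounded set of projections lies in the image of a compact set of symplectic
    matrices (sp_transitive); this makes the orbit map closed on saturated sets,
    and the bijection is a homeomorphism (orbit_coset_continuous).  The manifold
    structure of the quotient is transported along it.

    With N = g^-1 M, the orbit map reads b a^-1 in the charts, where a = E^+ N E
    and b = F^+ N E.  Along the tangent vector N X with X E = F A' its derivative
    is S A' a^-1, where S is the Schur complement of a in the invertible matrix
    N, so S is invertible and the orbit map is a submersion
    (frame_slope_surj). *)

Set Implicit Arguments.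
Unset Strict Implicit.
Unset Printing Implicit Defensive.

Import Order.TTheory GRing.Theory Num.Theory.
Import numFieldNormedType.Exports.

Local Open Scope classical_set_scope.
Local Open Scope ring_scope.

(** * Topology of matrix spaces *)

Section MatrixTopology.
Variable R : realType.

Lemma eq_continuous_at (T U : topologicalType) (f g : T -> U) x :
  f =1 g -> {for x, continuous f} -> {for x, continuous g}.
Proof. by move=> /funext ->. Qed.

Lemma mx_continuous_entrywise (T : topologicalType) m n (f : T -> 'M[R]_(m, n)) x :
  (forall i j, {for x, continuous (fun y => f y i j)}) -> {for x, continuous f}.
Proof.
move=> fc A [P fP PA].
have : \forall y \near x, forall i j, P i j (f y i j).
  by apply: filter_forall => i; apply: filter_forall => j; apply: fc; exact: fP.
by apply: filterS => y fy; apply: PA.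
Qed.

Lemma mx_entry_continuous (T : topologicalType) m n (f : T -> 'M[R]_(m, n)) x i j :
  {for x, continuous f} -> {for x, continuous (fun y => f y i j)}.
Proof.
move=> fc; apply: (@continuous_comp _ _ _ f (fun M : 'M[R]_(m, n) => M i j)) => //.
exact: coord_continuous.
Qed.

Lemma sum_continuous (T : topologicalType) (W : normedModType R) (I : Type)
    (r : seq I) (f : I -> T -> W) x :
  (forall i, {for x, continuous (f i)}) ->
  {for x, continuous (fun y => \sum_(i <- r) f i y)}.
Proof.
move=> fc; apply: cvg_big => [|i _]; [exact: add_continuous | exact: fc].
Qed.

Lemma prod_continuous (T : topologicalType) (I : Type)
    (r : seq I) (f : I -> T -> R) x :
  (forall i, {for x, continuous (f i)}) ->
  {for x, continuous (fun y => \prod_(i <- r) f i y)}.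
Proof.
move=> fc; apply: cvg_big => [|i _]; [exact: mul_continuous | exact: fc].
Qed.

(** In finite dimension linearity alone gives continuity: a linear map is a finite
    combination of coordinate functions. *)
Lemma mx_linear_continuous m n (W : normedModType R)
    (f : {linear 'M[R]_(m, n) -> W}) : continuous f.
Proof.
have -> : (f : _ -> _) = fun A => \sum_i \sum_j A i j *: f (delta_mx i j).
  apply/funext => A; rewrite {1}(matrix_sum_delta A) linear_sum.
  by under eq_bigr do (rewrite linear_sum; under eq_bigr do rewrite linearZ).
move=> A; apply: sum_continuous => i; apply: sum_continuous => j.
by apply: continuousZr_tmp; exact: coord_continuous.
Qed.

Lemma mulmx_continuous (T : topologicalType) m n p (f : T -> 'M[R]_(m, n))
    (g : T -> 'M[R]_(n, p)) x :
  {for x, continuous f} -> {for x, continuous g} ->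
  {for x, continuous (fun y => f y *m g y)}.
Proof.
move=> fc gc; apply: mx_continuous_entrywise => i j.
apply: (@eq_continuous_at T _ (fun y => \sum_k f y i k * g y k j)) => [y|].
  by rewrite mxE.
by apply: (@sum_continuous T R) => k; apply: continuousM; exact: mx_entry_continuous.
Qed.

Lemma det_continuous (T : topologicalType) n (f : T -> 'M[R]_n) x :
  {for x, continuous f} -> {for x, continuous (fun y => \det (f y))}.
Proof.
move=> fc; apply: (@sum_continuous T R) => s; apply: continuousM.
  exact: cvg_cst.
by apply: prod_continuous => i; exact: mx_entry_continuous.
Qed.

Lemma unitmx_near (T : topologicalType) n (f : T -> 'M[R]_n) x :
  {for x, continuous f} -> f x \in unitmx -> \forall y \near x, f y \in unitmx.
Proof.
move=> fc fx; have dx0 : \det (f x) != 0 by rewrite -unitfE -unitmxE.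
have : \forall y \near x, \det (f y) != 0.
  exact: (det_continuous fc (open_nbhs_nbhs (conj (@open_neq R 0) dx0))).
by apply: filterS => y dy; rewrite unitmxE unitfE.
Qed.

Lemma open_unitmx (T : topologicalType) n (f : T -> 'M[R]_n) :
  continuous f -> open [set x | f x \in unitmx].
Proof. by move=> fc; rewrite openE => x fx; exact: unitmx_near (fc x) fx. Qed.

(** Near an invertible matrix the inverse is given by Cramer's formula, whose
    entries are polynomials divided by the nonvanishing determinant. *)
Lemma invmx_continuous (T : topologicalType) n (f : T -> 'M[R]_n) x :
  {for x, continuous f} -> f x \in unitmx ->
  {for x, continuous (fun y => invmx (f y))}.
Proof.
move=> fc fx.
pose g y := (\det (f y))^-1 *: \adj (f y).
have dc := det_continuous fc.
have dx0 : \det (f x) != 0 by rewrite -unitfE -unitmxE.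
have eqfg : \forall y \near x, g y = invmx (f y).
  by apply: filterS (unitmx_near fc fx) => y fy; rewrite /invmx fy.
suff gc : {for x, continuous g}.
  rewrite /prop_for /continuous_at -(nbhs_singleton eqfg).
  exact: cvg_trans (near_eq_cvg eqfg) gc.
apply: continuousZ; first exact: continuousV.
apply: mx_continuous_entrywise => i j.
apply: (@eq_continuous_at T _ (fun y => cofactor (f y) j i)) => [y|].
  by rewrite mxE.
rewrite /cofactor; apply: continuousM; first exact: cvg_cst.
apply: det_continuous; apply: mx_continuous_entrywise => k l.
apply: (@eq_continuous_at T _ (fun y => f y (lift j k) (lift i l))) => [y|].
  by rewrite !mxE.
exact: mx_entry_continuous.
Qed.

Lemma mx_norm_entry m n (A : 'M[R]_(m, n)) i j : `|A i j| <= `|A|.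
Proof. by rewrite [leRHS]mx_normrE (le_bigmax _ _ (i, j)). Qed.

Lemma mx_norm_le m n (A : 'M[R]_(m, n)) c : 0 <= c ->
  (forall i j, `|A i j| <= c) -> `|A| <= c.
Proof. by move=> c0 Ac; rewrite [leLHS]mx_normrE bigmax_le// => -[i j] _. Qed.

Lemma mx_norm_mul m n p (A : 'M[R]_(m, n)) (B : 'M[R]_(n, p)) :
  `|A *m B| <= n%:R * `|A| * `|B|.
Proof.
apply: mx_norm_le => [|i j]; first by rewrite !mulr_ge0.
rewrite mxE (le_trans (ler_norm_sum _ _ _))//.
rewrite -[n in n%:R]card_ord -mulrA mulr_natl -sumr_const ler_sum// => k _.
by rewrite normrM ler_pM// mx_norm_entry.
Qed.

End MatrixTopology.

(** * Differentials of matrix expressions *)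

Section Differentials.
Variable R : realType.
Implicit Types V W : normedModType R.

(** A first-order expansion with a continuous linear part is both the proof of
    differentiability and the value of the differential. *)
Lemma differential_intro V W (f : V -> W) (df : {linear V -> W}) x :
  continuous df -> f \o shift x = cst (f x) + df +o_ 0 id ->
  differentiable f x /\ 'd f x = df :> (V -> W).
Proof.
move=> dfc fE; have dE := diff_unique dfc fE; split=> //.
by apply/diff_locallyP; rewrite dE.
Qed.

Lemma near_eq_differentiable V W (f g : V -> W) x :
  {near x, f =1 g} -> differentiable f x ->
  differentiable g x /\ 'd g x = 'd f x :> (V -> W).
Proof.
move=> fg df; apply: differential_intro; first exact: diff_continuous.
have /eqaddoP fo := diff_locally df.
apply/eqaddoP => e e0; near=> h.
have -> : (g \o shift x - (cst (g x) + 'd f x)) h =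
          (f \o shift x - (cst (f x) + 'd f x)) h.
  have gx : g x = f x by rewrite (nbhs_singleton fg).
  have gh : g (shift x h) = f (shift x h).
    by symmetry; near: h; move: fg; rewrite (near_shift 0)/= subr0.
  by rewrite !fctE /= gx; congr (_ - _).
by near: h; exact: fo.
Unshelve. all: by end_near. Qed.

Lemma derive_linear V W (f : {linear V -> W}) x v : continuous f -> 'D_v f x = f v.
Proof.
by move=> fc; rewrite deriveE ?diff_lin//; exact: linear_differentiable.
Qed.

Lemma derive_linear_comp V W W' (l : {linear W -> W'}) (f : V -> W) x v :
  continuous l -> differentiable f x ->
  differentiable (l \o f) x /\ 'D_v (l \o f) x = l ('D_v f x).
Proof.
move=> lc df; have dl := linear_differentiable (f x) lc.
have dlf := differentiable_comp df dl.
by split=> //; rewrite !deriveE// diff_comp//= diff_lin.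
Qed.

Section MatrixProduct.
Variables m n p : nat.

Lemma mulmx_is_bilinear :
  bilinear_for (GRing.Scale.Law.clone _ _ *:%R _) (GRing.Scale.Law.clone _ _ *:%R _)
    (@mulmx R m n p).
Proof.
split=> [u'|u] a x y /=; first by rewrite mulmxDl scalemxAl.
by rewrite mulmxDr scalemxAr.
Qed.

HB.instance Definition _ := bilinear_isBilinear.Build R
  'M[R]_(m, n) 'M[R]_(n, p) 'M[R]_(m, p) _ _ (@mulmx R m n p) mulmx_is_bilinear.

Lemma derive_mulmx V (f : V -> 'M[R]_(m, n)) (g : V -> 'M[R]_(n, p)) x v :
  differentiable f x -> differentiable g x ->
  differentiable (fun y => f y *m g y) x /\
  'D_v (fun y => f y *m g y) x = f x *m 'D_v g x + 'D_v f x *m g x.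
Proof.
move=> df dg.
have mc : continuous (fun q : 'M[R]_(m, n) * 'M[R]_(n, p) => q.1 *m q.2).
  by move=> q; apply: mulmx_continuous; [exact: cvg_fst | exact: cvg_snd].
pose fg y := (f y, g y).
have dfg : differentiable fg x by exact: differentiable_pair.
have dm := differentiable_bilin (fg x) mc.
have dd := differentiable_comp dfg dm; split=> //.
by rewrite !deriveE// (diff_comp dfg dm) /= (diff_bilin (fg x) mc) diff_pair.
Qed.

End MatrixProduct.

(** The resolvent identity B^-1 - A^-1 + A^-1 (B - A) A^-1 = (A^-1 - B^-1)(B - A) A^-1
    reduces the first-order expansion of the inverse to its continuity. *)
Lemma derive_invmx_id n (A h : 'M[R]_n) : A \in unitmx ->
  differentiable invmx A /\ 'D_h invmx A = - (invmx A *m h *m invmx A).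
Proof.
move=> uA.
pose d (k : 'M[R]_n) := - (invmx A *m k *m invmx A).
have dl : linear d.
  move=> a u v; rewrite /d mulmxDr mulmxDl opprD scalerN.
  by rewrite -!(scalemxAl, scalemxAr).
pose dM := GRing.isLinear.Build _ _ _ _ _ dl.
pose dL : {linear _ -> _} := HB.pack d dM.
have dc : continuous dL by exact: mx_linear_continuous.
suff [df dE] : differentiable invmx A /\ 'd invmx A = dL :> (_ -> _).
  by split=> //; rewrite deriveE// dE.
apply: differential_intro => //; apply/eqaddoP => e e0.
have sc : {for (0 : 'M[R]_n), continuous (shift A)}.
  by apply: (@continuousD R 'M[R]_n 'M[R]_n id (cst A)); [exact: cvg_id|exact: cst_continuous].
have s0 : shift A (0 : 'M[R]_n) = A by rewrite /= add0r.
have s0u : shift A (0 : 'M[R]_n) \in unitmx by rewrite s0.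
(* The remainder is at most n^2 e' |A^-1| |h| once |A^-1 - (A+h)^-1| <= e';
   taking e' = e / c absorbs the constant. *)
pose c := n%:R * (n%:R * `|invmx A|) + 1.
have c0 : 0 < c by rewrite ltr_wpDl ?mulr_ge0.
have un := unitmx_near sc s0u.
have := invmx_continuous sc s0u; rewrite {1}/prop_for /continuous_at s0.
move=> /cvgrPdist_le/(_ (e / c)) /(_ (divr_gt0 e0 c0)) ic.
near=> h0.
have uh : shift A h0 \in unitmx by near: h0.
have -> : (invmx \o shift A - (cst (invmx A) + dL)) h0 =
   (invmx A - invmx (shift A h0)) *m h0 *m invmx A.
  have hE : h0 = shift A h0 - A by rewrite /= addrK.
  rewrite -[LHS]/(invmx (shift A h0) - (invmx A - invmx A *m h0 *m invmx A)).
  move: (shift A h0) uh hE => B uB ->.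
  have YX : invmx B *m (B - A) *m invmx A = invmx A - invmx B.
    by rewrite mulmxBr mulVmx// mulmxBl mul1mx -mulmxA mulmxV// mulmx1.
  by rewrite !mulmxBl YX !opprB addrA addrAC addrA [LHS]addrC addrA addrAC.
have hi : `|invmx A - invmx (shift A h0)| <= e / c by near: h0.
rewrite (le_trans (mx_norm_mul _ _))// (le_trans (ler_pM _ _ (lexx _) (lexx _)))//.
rewrite (@le_trans _ _ (n%:R * (n%:R * (e / c) * `|h0|) * `|invmx A|))//.
  rewrite ler_wpM2r// ler_wpM2l// (le_trans (mx_norm_mul _ _))//.
  by rewrite ler_wpM2r// ler_wpM2l.
rewrite (_ : _ * _ = (n%:R * (n%:R * `|invmx A|)) / c * (e * `|h0|)).
  by apply: ler_piMl; [rewrite mulr_ge0// ltW | rewrite ler_pdivrMr// mul1r lerDl].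
by rewrite /=; ring.
Unshelve. all: by end_near. Qed.

Lemma derive_invmx V n (f : V -> 'M[R]_n) x v :
  differentiable f x -> f x \in unitmx ->
  differentiable (fun y => invmx (f y)) x /\
  'D_v (fun y => invmx (f y)) x = - (invmx (f x) *m 'D_v f x *m invmx (f x)).
Proof.
move=> df fx; have [di diE] := derive_invmx_id ('D_v f x) fx.
have dc : differentiable (invmx \o f) x by exact: differentiable_comp.
split; first exact: dc.
have E : 'd (invmx \o f) x v = 'd invmx (f x) ('d f x v).
  exact: (congr1 (@^~ v) (diff_comp df di)).
apply: (etrans (deriveE v dc)); apply: (etrans E).
rewrite -diE; apply: (etrans _ (esym (deriveE _ di))).
by congr ('d _ _ _); rewrite deriveE.
Qed.

End Differentials.

(** * Smooth maps *)

Section SmoothCalculus.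
Variable R : realType.
Implicit Types V W : normedModType R.

Lemma Ck_on_continuous V W k (U : set V) (f : V -> W) x :
  Ck_on k U f -> U x -> {for x, continuous f}.
Proof.
case: k => [fc|k [df _]] Ux; first exact: fc.
by apply: differentiable_continuous; exact: df.
Qed.

Lemma Ck_on_differentiable V W k (U : set V) (f : V -> W) x :
  Ck_on k.+1 U f -> U x -> differentiable f x.
Proof. by case=> df _; exact: df. Qed.

Lemma Ck_on_weaken V W k (U : set V) (f : V -> W) : Ck_on k.+1 U f -> Ck_on k U f.
Proof.
elim: k f => [|k IH] f fk.
  by move=> x Ux; apply: differentiable_continuous; exact: (Ck_on_differentiable fk Ux).
by case: fk => df dfk; split=> // v; exact: IH.
Qed.

Lemma Ck_on_subset V W k (U U' : set V) (f : V -> W) :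
  U' `<=` U -> Ck_on k U f -> Ck_on k U' f.
Proof.
move=> sU; elim: k f => [|k IH] f; first by move=> fc x /sU; exact: fc.
by case=> df dfk; split=> [x /sU|v]; [exact: df | exact: IH (dfk v)].
Qed.

Lemma open_near_eq V (T : Type) (U : set V) (f g : V -> T) x :
  open U -> {in U, f =1 g} -> U x -> {near x, f =1 g}.
Proof.
move=> oU fg Ux; have : \forall y \near x, U y by exact: open_nbhs_nbhs (conj oU Ux).
by apply: filterS => y Uy; apply: fg; rewrite inE.
Qed.

Lemma eq_Ck_on V W k (U : set V) (f g : V -> W) :
  open U -> {in U, f =1 g} -> Ck_on k U f -> Ck_on k U g.
Proof.
move=> oU; elim: k f g => [|k IH] f g fg.
  move=> fc x Ux; have fgx := open_near_eq oU fg Ux.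
  rewrite /prop_for /continuous_at -(nbhs_singleton fgx).
  exact: cvg_trans (near_eq_cvg fgx) (fc _ Ux).
case=> df dfk; split=> [x Ux|v].
  by have [] := near_eq_differentiable (open_near_eq oU fg Ux) (df _ Ux).
apply: IH (dfk v) => x; rewrite inE => Ux.
exact: near_eq_derive (open_near_eq oU fg Ux).
Qed.

Lemma Ck_on_cst V W k (U : set V) (c : W) : Ck_on k U (fun=> c).
Proof.
elim: k c => [|k IH] c; first by move=> x _; exact: cst_continuous.
split=> [x _|v]; first exact: differentiable_cst.
have -> : (fun x => 'D_v (fun=> c) x) = (fun=> 0) :> (V -> W).
  by apply/funext => x; exact: derive_cst.
exact: IH.
Qed.

Lemma Ck_on_id V k (U : set V) : Ck_on k U (id : V -> V).
Proof.
case: k => [x _|k]; first exact: cvg_id.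
split=> [x _|v]; first by [].
have -> : (fun x => 'D_v id x) = (fun=> v) :> (V -> V).
  by apply/funext => x; exact: derive_id.
exact: Ck_on_cst.
Qed.

Lemma Ck_on_linear_comp V W W' k (U : set V) (l : {linear W -> W'}) (f : V -> W) :
  open U -> continuous l -> Ck_on k U f -> Ck_on k U (fun x => l (f x)).
Proof.
move=> oU lc; elim: k f => [|k IH] f.
  move=> fc x Ux.
  by apply: (@continuous_comp _ _ _ f l); [exact: fc | exact: lc].
case=> df dfk; split=> [x Ux|v].
  by have [] := derive_linear_comp 0 lc (df _ Ux).
apply: (@eq_Ck_on _ _ _ _ (fun x => l ('D_v f x))) => // [x|]; last exact: IH (dfk v).
by rewrite inE => Ux; have [_ ->] := derive_linear_comp v lc (df _ Ux).
Qed.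

Lemma Ck_on_linear m n W k (U : set 'M[R]_(m, n)) (l : {linear 'M[R]_(m, n) -> W}) :
  open U -> Ck_on k U (fun x => l x).
Proof.
move=> oU; apply: Ck_on_linear_comp => //; last exact: Ck_on_id.
exact: mx_linear_continuous.
Qed.

Lemma Ck_on_add V W k (U : set V) (f g : V -> W) :
  open U -> Ck_on k U f -> Ck_on k U g -> Ck_on k U (fun x => f x + g x).
Proof.
move=> oU; elim: k f g => [|k IH] f g.
  by move=> fc gc x Ux; apply: continuousD; [exact: fc | exact: gc].
move=> [df dfk] [dg dgk]; split=> [x Ux|v].
  by apply: differentiableD; [exact: df | exact: dg].
apply: (@eq_Ck_on _ _ _ _ (fun x => 'D_v f x + 'D_v g x)) => // [x|];
  last exact: IH (dfk v) (dgk v).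
by rewrite inE => Ux; rewrite deriveD//; apply: diff_derivable; [exact: df|exact: dg].
Qed.

Lemma Ck_on_opp V W k (U : set V) (f : V -> W) :
  open U -> Ck_on k U f -> Ck_on k U (fun x => - f x).
Proof.
move=> oU; elim: k f => [|k IH] f.
  by move=> fc x Ux; apply: continuousN; exact: fc.
move=> [df dfk]; split=> [x Ux|v]; first by apply: differentiableN; exact: df.
apply: (@eq_Ck_on _ _ _ _ (fun x => - 'D_v f x)) => // [x|]; last exact: IH (dfk v).
by rewrite inE => Ux; rewrite deriveN//; apply: diff_derivable; exact: df.
Qed.

Lemma Ck_on_mul V k (U : set V) m n p (f : V -> 'M[R]_(m, n)) (g : V -> 'M[R]_(n, p)) :
  open U -> Ck_on k U f -> Ck_on k U g -> Ck_on k U (fun x => f x *m g x).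
Proof.
move=> oU; elim: k f g => [|k IH] f g.
  by move=> fc gc x Ux; apply: mulmx_continuous; [exact: fc | exact: gc].
move=> fk gk; have [df dfk] := fk; have [dg dgk] := gk; split=> [x Ux|v].
  by have [] := derive_mulmx 0 (df _ Ux) (dg _ Ux).
apply: (@eq_Ck_on _ _ _ _ (fun x => f x *m 'D_v g x + 'D_v f x *m g x)) => // [x|].
  by rewrite inE => Ux; have [_ ->] := derive_mulmx v (df _ Ux) (dg _ Ux).
apply: Ck_on_add => //; first exact: IH (Ck_on_weaken fk) (dgk v).
exact: IH (dfk v) (Ck_on_weaken gk).
Qed.

Lemma Ck_on_inv V k (U : set V) n (f : V -> 'M[R]_n) :
  open U -> (forall x, U x -> f x \in unitmx) -> Ck_on k U f ->
  Ck_on k U (fun x => invmx (f x)).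
Proof.
move=> oU fu; elim: k => [|k IH].
  by move=> fc x Ux; apply: invmx_continuous; [exact: fc | exact: fu].
move=> fk; have [df dfk] := fk; split=> [x Ux|v].
  by have [] := derive_invmx 0 (df _ Ux) (fu _ Ux).
apply: (@eq_Ck_on _ _ _ _
  (fun x => - (invmx (f x) *m 'D_v f x *m invmx (f x)))) => // [x|].
  by rewrite inE => Ux; have [_ ->] := derive_invmx v (df _ Ux) (fu _ Ux).
have ik := IH (Ck_on_weaken fk).
by apply: Ck_on_opp => //; apply: Ck_on_mul => //; exact: Ck_on_mul oU ik (dfk v).
Qed.

Lemma Ck_on_sum V W k (U : set V) (I : Type) (r : seq I) (f : I -> V -> W) :
  open U -> (forall i, Ck_on k U (f i)) -> Ck_on k U (fun x => \sum_(i <- r) f i x).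
Proof.
move=> oU fk; elim: r => [|i r IH].
  by apply: (eq_Ck_on oU _ (@Ck_on_cst _ _ _ _ 0)) => x _; rewrite big_nil.
by apply: (eq_Ck_on oU _ (Ck_on_add oU (fk i) IH)) => x _; rewrite big_cons.
Qed.

(** The iterated directional derivatives of g o f involve the differential of g
    at f x in the varying direction D_v f x.  Expanding this direction in the
    standard basis leaves only derivatives of g in fixed directions, to which
    induction applies. *)
Lemma Ck_on_comp V m n p q k (U : set V) (U' : set 'M[R]_(m, n))
    (f : V -> 'M[R]_(m, n)) (g : 'M[R]_(m, n) -> 'M[R]_(p, q)) :
  open U -> (forall x, U x -> U' (f x)) ->
  Ck_on k U f -> Ck_on k U' g -> Ck_on k U (fun x => g (f x)).
Proof.
move=> oU UU'; elim: k f g UU' => [|k IH] f g UU'.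
  move=> fc gc x Ux.
  by apply: (@continuous_comp _ _ _ f g); [exact: fc | exact/gc/UU'].
move=> fk gk; have [df dfk] := fk; have [dg dgk] := gk.
split=> [x Ux|v].
  by apply: (@differentiable_comp _ _ _ _ f g); [exact: df | exact/dg/UU'].
(* Scalar multiplication by a matrix entry is written as multiplication by a
   scalar matrix, so that the product rule for matrices suffices. *)
pose ent i j (A : 'M[R]_(m, n)) : 'M[R]_p := (A i j)%:M.
have entl i j : linear (ent i j).
  by move=> a A B; rewrite /ent !mxE raddfD/= -scale_scalar_mx.
pose entL i j : {linear 'M[R]_(m, n) -> 'M[R]_p} :=
  HB.pack (ent i j) (GRing.isLinear.Build _ _ _ _ _ (entl i j)).
apply: (@eq_Ck_on _ _ _ _ (fun x => \sum_i \sum_j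
  entL i j ('D_v f x) *m 'D_(delta_mx i j) g (f x))) => // [x|].
  rewrite inE => Ux; have dgx := dg _ (UU' _ Ux); have dfx := df _ Ux.
  have dgf : differentiable (g \o f) x by exact: differentiable_comp.
  have E : 'd (g \o f) x v = 'd g (f x) ('d f x v).
    exact: (congr1 (@^~ v) (diff_comp dfx dgx)).
  apply: (etrans _ (esym (etrans (deriveE v dgf) E))).
  rewrite (deriveE v dfx); move: ('d f x v) => A.
  rewrite [in RHS](matrix_sum_delta A) linear_sum; apply: eq_bigr => i _.
  rewrite linear_sum; apply: eq_bigr => j _.
  by rewrite linearZ /= /ent mul_scalar_mx (deriveE _ dgx).
apply: Ck_on_sum => // i; apply: Ck_on_sum => // j.
apply: Ck_on_mul => //; last exact: IH (Ck_on_weaken fk) (dgk _).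
by apply: Ck_on_linear_comp (dfk v) => //; exact: mx_linear_continuous.
Qed.

End SmoothCalculus.

(** * Subspaces and countability *)

Section PointSetTopology.
Variable R : realType.

Lemma open_preimage_on (T U : topologicalType) (A : set T) (B : set U) (f : T -> U) :
  open A -> (forall x, A x -> {for x, continuous f}) -> open B ->
  open (A `&` f @^-1` B).
Proof.
move=> oA fc oB; rewrite openE => x [Ax Bfx]; apply: filterI.
  exact: open_nbhs_nbhs (conj oA Ax).
exact: (fc _ Ax _ (open_nbhs_nbhs (conj oB Bfx))).
Qed.

Lemma set_val_continuous (T : topologicalType) (S : set T) :
  continuous (set_val : S -> T).
Proof. exact: initial_continuous. Qed.

Lemma continuous_at_subtype (T U : topologicalType) (S : set U) (f : T -> S) x :
  {for x, continuous (fun y => set_val (f y))} -> {for x, continuous f}.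
Proof.
move=> fc A [B [[C oC CB] Bfx] BA].
have Cfx : C (set_val (f x)) by move: Bfx; rewrite -CB.
have : \forall y \near x, C (set_val (f y)).
  exact: (fc _ (open_nbhs_nbhs (conj oC Cfx))).
by apply: filterS => y Cy; apply: BA; rewrite -CB.
Qed.

Lemma nbhs_subtype (T : topologicalType) (S : set T) (x : S) (A : set S) :
  nbhs x A -> exists2 B, nbhs (set_val x) B & set_val @^-1` B `<=` A.
Proof.
move=> [_ [[C oC <-] Cx] CA]; exists C => //.
exact: open_nbhs_nbhs (conj oC Cx).
Qed.

Lemma hausdorff_injective (T U : topologicalType) (f : T -> U) :
  continuous f -> injective f -> hausdorff_space U -> hausdorff_space T.
Proof.
move=> fc fi hU p q pq; apply/fi/hU => A B Ap Bq.
by have [x [Ax Bx]] := pq _ _ (fc _ _ Ap) (fc _ _ Bq); exists (f x).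
Qed.

(** Stated for maps whose source has the topology induced from the target, so
    that it serves both for subspaces and for homeomorphisms. *)
Lemma second_countable_embedding (T U : topologicalType) (f : T -> U) :
  continuous f ->
  (forall x A, nbhs x A -> exists2 B, nbhs (f x) B & f @^-1` B `<=` A) ->
  @second_countable U -> @second_countable T.
Proof.
move=> fc fA [D cD [Do Db]]; exists [set f @^-1` B | B in D].
  exact: sub_countable (card_image_le _ _) cD.
split=> [_ [B DB <-]|x A /fA[B Bx BA]].
  by apply: open_comp => [y _|]; [exact: fc | exact: Do].
have [C [DC Cx] CB] := Db _ _ Bx.
exists (f @^-1` C); first by split=> //; exists C.
by move=> y Cy; apply: BA; exact: CB.
Qed.

(** The balls with rational centre and radius 1/(k+1) form a basis. *)
Lemma mx_second_countable m n : @second_countable 'M[R]_(m, n).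
Proof.
pose b (qk : 'M[rat]_(m, n) * nat) : set 'M[R]_(m, n) :=
  ball (map_mx ratr qk.1 : 'M[R]_(m, n)) qk.2.+1%:R^-1.
exists (range b); first exact: sub_countable (card_image_le _ _) (countableP _).
split=> [_ [qk _ <-]|x A /nbhs_ballP[e /= e0 eA]]; first exact: ball_open.
have [k ke] : exists k, k.+1%:R^-1 < e / 2 
  by have [k] := @ltr_add_invr R 0 (e / 2) (divr_gt0 e0 (ltr0Sn _ _)); rewrite add0r; exists k.
have k0 : (0 : R) < k.+1%:R^-1 by rewrite invr_gt0.
have qP i j : exists q : rat, `|x i j - ratr q| < k.+1%:R^-1.
  move: k.+1%:R^-1 k0 => d d0.
  have lt : x i j - d < x i j + d by lra.
  have [q] := rat_in_itvoo lt; rewrite in_itv/= => /andP[a1 a2].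
  by exists q; rewrite ltr_norml ltrBrDr addrC -ltrBrDr opprK a2 ltrBlDr addrC -ltrBlDr a1.
pose Q : 'M[rat]_(m, n) := \matrix_(i, j) sval (cid (qP i j)).
have Qx : ball (map_mx ratr Q : 'M[R]_(m, n)) k.+1%:R^-1 x.
  split=> // i j; rewrite /ball/= !mxE distrC.
  by case: cid.
exists (b (Q, k)); first by split=> //; exists (Q, k).
move=> y Qy; apply: eA; rewrite [e](splitr e).
by apply: (@ball_triangle _ _ (map_mx ratr Q : 'M[R]_(m, n))); apply: le_ball (ltW ke) _ _ => //;
  exact: ball_sym.
Qed.

End PointSetTopology.

(** * Charts induced from the ambient space *)

Section InducedCharts.
Variables (R : realType) (p q : nat).

(** A chart of a subset S of a matrix space, given by maps defined on open sets
    of the ambient space rather than on S: smoothness of transition maps then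
    follows from the smoothness of composites, without any calculus on S. *)
Record ambient_chart (d : nat) := AmbientChart {
  amb_dom : set 'M[R]_(p, q);
  amb_fun : 'M[R]_(p, q) -> 'rV[R]_d;
  amb_cod : set 'rV[R]_d;
  amb_inv : 'rV[R]_d -> 'M[R]_(p, q) }.

Definition is_ambient_chart (S : set 'M[R]_(p, q)) d (a : ambient_chart d) : Prop :=
  [/\ open (amb_dom a) /\ open (amb_cod a),
      smooth_on (amb_dom a) (amb_fun a),
      smooth_on (amb_cod a) (amb_inv a),
      (forall x, S x -> amb_dom a x ->
         amb_cod a (amb_fun a x) /\ amb_inv a (amb_fun a x) = x) &
      (forall v, amb_cod a v ->
         [/\ S (amb_inv a v), amb_dom a (amb_inv a v) &
             amb_fun a (amb_inv a v) = v])].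

Variables (S : set 'M[R]_(p, q)) (s0 : S) (d : nat).
Implicit Types a b : ambient_chart d.

(** The total inverse of the chart must take values in S; outside the domain of
    the parametrization it returns the arbitrary point s0. *)
Definition induced_chart a : chart R S d :=
  Chart [set x : S | amb_dom a (set_val x)] (fun x => amb_fun a (set_val x))
        (fun v => insubd s0 (amb_inv a v)).

Lemma induced_chart_invE a v : is_ambient_chart S a -> amb_cod a v ->
  set_val (chart_inv (induced_chart a) v) = amb_inv a v.
Proof.
move=> [_ _ _ _ ha] /ha[Sv _ _].
by rewrite set_valE /= val_insubd (mem_set Sv).
Qed.

Lemma induced_chart_codom a : is_ambient_chart S a ->
  chart_codom (induced_chart a) = amb_cod a.
Proof.
move=> ha; have [_ _ _ h1 h2] := ha; apply/seteqP; split=> [v [x /= Dx <-]|v av].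
  by have [] := h1 _ (set_valP x) Dx.
have [Sv Dv vE] := h2 _ av.
by exists (@exist _ (fun x => x \in S) _ (mem_set Sv)).
Qed.

Lemma induced_chart_is_chart a : is_ambient_chart S a -> is_chart (induced_chart a).
Proof.
move=> ha; have [[oD oO] sf si h1 h2] := ha; split.
- by apply: open_comp => [x _|//]; exact: set_val_continuous.
- by rewrite induced_chart_codom.
- move=> x /= Dx; have [Ofx fK] := h1 _ (set_valP x) Dx.
  by apply/val_inj; rewrite /= val_insubd fK (mem_set (set_valP x)).
- apply: continuous_in_subspaceT => x; rewrite inE => Dx.
  apply: (@continuous_comp _ _ _ set_val (amb_fun a)).
    exact: set_val_continuous.
  exact: (Ck_on_continuous (sf 0)).
- apply: continuous_in_subspaceT => v; rewrite inE induced_chart_codom// => Ov.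
  apply: continuous_at_subtype.
  have vE : {near v, amb_inv a =1 fun w => set_val (chart_inv (induced_chart a) w)}.
    apply: filterS (open_nbhs_nbhs (conj oO Ov)) => w Ow.
    by rewrite induced_chart_invE.
  rewrite /prop_for /continuous_at -(nbhs_singleton vE).
  exact: cvg_trans (near_eq_cvg vE) (Ck_on_continuous (si 0) Ov).
Qed.

(** The form in which smoothness of maps into S is proved: the local expression of
    f in charts is the ambient chart map composed with any smooth ambient
    expression h of f, on an open set that contains the domain of the local expression. *)
Lemma induced_local_rep_smooth (X : topologicalType) n (c : chart R X n) a
    (f : X -> S) (U : set 'rV[R]_n) (h : 'rV[R]_n -> 'M[R]_(p, q)) :
  is_ambient_chart S a -> open U -> smooth_on U h ->
  (forall v, U v -> set_val (f (chart_inv c v)) = h v) ->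
  local_dom c (induced_chart a) f `<=` U ->
  (forall x, chart_dom c x -> chart_inv c (chart_fun c x) = x) ->
  smooth_on (local_dom c (induced_chart a) f) (local_rep c (induced_chart a) f).
Proof.
move=> [[oD oO] sf _ _ _] oU sh fE domU cK k.
pose O := U `&` h @^-1` amb_dom a.
have oO' : open O.
  by apply: open_preimage_on => // v Uv; exact: (Ck_on_continuous (sh 0)).
apply: (@Ck_on_subset _ _ _ _ O).
  move=> v Dv; split; first exact: domU.
  have := domU _ Dv; case: Dv => x [cx fx] <- Ux /=.
  by rewrite -(fE _ Ux) cK.
apply: (@eq_Ck_on _ _ _ _ _ (fun v => amb_fun a (h v))) => // [v|].
  by rewrite inE => -[Uv _]; rewrite /local_rep /= fE.
apply: (Ck_on_comp (U' := amb_dom a)) => // [v [_ Dv]//|].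
by apply: Ck_on_subset (sh k) => v [].
Qed.

(** The inclusion is an immersion because the parametrization has the smooth
    left inverse amb_fun, so its differential has a left inverse as well. *)
Lemma induced_atlas (I : set (ambient_chart d)) :
  (forall a, I a -> is_ambient_chart S a) ->
  (forall x, S x -> exists2 a, I a & amb_dom a x) ->
  embedded_submanifold (induced_chart @` I).
Proof.
move=> hI cover; split; first split.
- apply: hausdorff_injective (@set_val_continuous _ S) _ _.
    exact: val_inj.
  exact: norm_hausdorff.
- apply: second_countable_embedding (@set_val_continuous _ S) _ _.
    exact: nbhs_subtype.
  exact: mx_second_countable.
- split=> [_ [a Ia <-]|x|_ _ [a Ia <-] [b Ib <-]].
  + exact/induced_chart_is_chart/hI.
  + have [a Ia ax] := cover _ (set_valP x).
    by exists (induced_chart a) => //; exists a.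
  + have ha := hI _ Ia; have [_ _ cK _ _] := induced_chart_is_chart ha.
    have [[_ oO] _ si h1 _] := ha.
    apply: (@induced_local_rep_smooth _ _ _ _ _ (amb_cod a) (amb_inv a)) => //.
    * exact: hI.
    * by move=> v; exact: induced_chart_invE.
    * by move=> _ [x [Dx _] <-]; have [] := h1 _ (set_valP x) Dx.
move=> _ [a Ia <-]; have ha := hI _ Ia; rewrite induced_chart_codom//.
have [[oD oO] sf si h1 h2] := ha.
have E : {in amb_cod a, amb_inv a =1 fun v => set_val (chart_inv (induced_chart a) v)}.
  by move=> v; rewrite inE => /induced_chart_invE ->.
split=> [k|v Ov]; first exact: eq_Ck_on oO E (si k).
have [dg dgE] := near_eq_differentiable (open_near_eq oO E Ov)
  (Ck_on_differentiable (si 1) Ov).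
rewrite dgE; have [_ Dv _] := h2 _ Ov.
have di := Ck_on_differentiable (si 1) Ov.
have df := Ck_on_differentiable (sf 1) Dv.
have idE : {in amb_cod a, id =1 amb_fun a \o amb_inv a}.
  by move=> w; rewrite inE => /h2[_ _ /= ->].
have did : differentiable (id : 'rV[R]_d -> 'rV[R]_d) v by [].
have [_ E1] := near_eq_differentiable (open_near_eq oO idE Ov) did.
have E2 := diff_comp di df.
have E3 w : 'd (amb_fun a) (amb_inv a v) ('d (amb_inv a) v w) = w.
  by rewrite -[LHS]/(('d (amb_fun a) (amb_inv a v) \o 'd (amb_inv a) v) w) -E2 E1
             diff_val.
exact: (can_inj E3).
Qed.

End InducedCharts.

Section Pullback.
Variables (R : realType) (X Y : topologicalType) (d : nat).
Variables (F : X -> Y) (G : Y -> X).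
Hypotheses (FK : cancel F G) (GK : cancel G F).
Hypotheses (Fc : continuous F) (Gc : continuous G).

Definition pullback_chart (c : chart R Y d) : chart R X d :=
  Chart (F @^-1` chart_dom c) (chart_fun c \o F) (G \o chart_inv c).

Lemma image_preimage_homeo (T : Type) (f : Y -> T) (A : set Y) :
  (f \o F) @` (F @^-1` A) = f @` A.
Proof.
apply/seteqP; split=> [_ [x Ax <-]|_ [y Ay <-]]; first by exists (F x).
by exists (G y); rewrite /= GK.
Qed.

Lemma pullback_chart_codom c : chart_codom (pullback_chart c) = chart_codom c.
Proof. exact: image_preimage_homeo. Qed.

Lemma pullback_local_domr (Z : topologicalType) e (c : chart R Z e) c' (f : Z -> X) :
  local_dom c (pullback_chart c') f = local_dom c c' (F \o f).
Proof. by []. Qed.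

Lemma pullback_local_repr (Z : topologicalType) e (c : chart R Z e) c' (f : Z -> X) :
  local_rep c (pullback_chart c') f = local_rep c c' (F \o f).
Proof. by []. Qed.

Lemma pullback_local_doml (Z : topologicalType) e c (c' : chart R Z e) (f : Y -> Z) :
  local_dom (pullback_chart c) c' (f \o F) = local_dom c c' f.
Proof. exact: image_preimage_homeo. Qed.

Lemma pullback_local_repl (Z : topologicalType) e c (c' : chart R Z e) (f : Y -> Z) :
  local_rep (pullback_chart c) c' (f \o F) = local_rep c c' f.
Proof. by apply/funext => v; rewrite /local_rep /= GK. Qed.

Lemma pullback_chart_is_chart c : is_chart c -> is_chart (pullback_chart c).
Proof.
move=> [oD oC cK fc ic]; split; rewrite ?pullback_chart_codom//.
- by apply: open_comp => // x _; exact: Fc.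
- by move=> x /= Dx; rewrite cK.
- apply: continuous_in_subspaceT => x; rewrite inE => /= Dx.
  apply: (@continuous_comp _ _ _ F (chart_fun c)); first exact: Fc.
  by move: fc; rewrite continuous_open_subspace//; apply; rewrite inE.
- apply: continuous_in_subspaceT => v; rewrite inE => Cv.
  apply: (@continuous_comp _ _ _ (chart_inv c) G); last exact: Gc.
  by move: ic; rewrite continuous_open_subspace//; apply; rewrite inE.
Qed.

Variable A : set (chart R Y d).
Hypothesis AY : smooth_manifold A.

Lemma pullback_manifold : smooth_manifold (pullback_chart @` A).
Proof.
have [hY sY [Ac Acov Asm]] := AY; split.
- exact: hausdorff_injective Fc (can_inj FK) hY.
- apply: second_countable_embedding Fc _ sY => x B Bx.
  exists (G @^-1` B); first by apply: Gc; rewrite FK.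
  by move=> y /=; rewrite FK.
- split=> [_ [c Ac' <-]|x|_ _ [c Ac' <-] [c' Ac'' <-]].
  + exact/pullback_chart_is_chart/Ac.
  + by have [c Ac' cx] := Acov (F x); exists (pullback_chart c) => //; exists c.
  + rewrite pullback_local_domr pullback_local_repr.
    rewrite -[F \o id]/(id \o F) pullback_local_doml pullback_local_repl.
    exact: Asm.
Qed.

Lemma pullback_diffeomorphism : diffeomorphism (pullback_chart @` A) A F.
Proof.
have [_ _ [_ _ Asm]] := AY; split.
  split=> // _ c' [c Ac <-] Ac'.
  by rewrite -[F]/(id \o F) pullback_local_doml pullback_local_repl; exact: Asm.
exists G; split=> //; split=> // c _ Ac [c' Ac' <-].
rewrite pullback_local_domr pullback_local_repr.
by rewrite (_ : F \o G = id); [exact: Asm | apply/funext => y; exact: GK].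
Qed.

End Pullback.

(** * Symplectic frames *)

Section SymplecticFrames.
Variable R : realType.

Lemma sadj_is_linear a b : linear (@sadj R a b).
Proof.
move=> x A B; rewrite /sadj linearP /= mulmxDr mulmxDl.
by rewrite -!(scalemxAl, scalemxAr).
Qed.

HB.instance Definition _ a b :=
  GRing.isLinear.Build _ _ _ _ (@sadj R a b) (@sadj_is_linear a b).

(** The symplectic inclusions of the two summands; in the splitting of R^2m into
    position and momentum halves each acts diagonally. *)
Definition incl1 k l : 'M[R]_((k + l) + (k + l), k + k) :=
  block_mx (col_mx 1%:M 0) 0 0 (col_mx 1%:M 0).

Definition incl2 k l : 'M[R]_((k + l) + (k + l), l + l) :=
  block_mx (col_mx 0 1%:M) 0 0 (col_mx 0 1%:M).

Lemma sadj_diag a b (X : 'M[R]_(a, b)) :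
  sadj (block_mx X 0 0 X) = block_mx X^T 0 0 X^T.
Proof.
rewrite /sadj JtrE tr_block_mx !trmx0 /J opp_block_mx !mulmx_block.
by rewrite !(oppr0, opprK, mul0mx, mulmx0, mul1mx, mulmx1, mulNmx, mulmxN,
             addr0, add0r).
Qed.

Lemma sadj_fixE n (P : 'M[R]_(n + n)) : sadj P = P -> P^T *m J R n = J R n *m P.
Proof. by move=> sP; rewrite -[in RHS]sP /sadj !mulmxA JJtr mul1mx. Qed.

Lemma sadj_fixI n (P : 'M[R]_(n + n)) : P^T *m J R n = J R n *m P -> sadj P = P.
Proof. by move=> PJ; rewrite /sadj -mulmxA PJ mulmxA JtrJ mul1mx. Qed.

Lemma mul_sadj_J n a (W : 'M[R]_(n + n, a + a)) :
  sadj W *m W = (J R a)^T *m (W^T *m J R n *m W).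
Proof. by rewrite /sadj !mulmxA. Qed.

Lemma incl1K k l : sadj (incl1 k l) *m incl1 k l = 1%:M.
Proof.
rewrite sadj_diag mulmx_block !(mul0mx, mulmx0, addr0, add0r) tr_col_mx.
by rewrite mul_row_col trmx1 mulmx1 mulmx0 addr0 -scalar_mx_block.
Qed.

Lemma incl2K k l : sadj (incl2 k l) *m incl2 k l = 1%:M.
Proof.
rewrite sadj_diag mulmx_block !(mul0mx, mulmx0, addr0, add0r) tr_col_mx.
by rewrite mul_row_col trmx1 mulmx1 mulmx0 add0r -scalar_mx_block.
Qed.

Lemma incl12 k l : sadj (incl1 k l) *m incl2 k l = 0.
Proof.
rewrite sadj_diag mulmx_block !(mul0mx, mulmx0, addr0, add0r) tr_col_mx.
by rewrite mul_row_col trmx1 trmx0 mulmx0 mul0mx addr0 block_mx0.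
Qed.

Lemma incl21 k l : sadj (incl2 k l) *m incl1 k l = 0.
Proof.
rewrite sadj_diag mulmx_block !(mul0mx, mulmx0, addr0, add0r) tr_col_mx.
by rewrite mul_row_col trmx1 trmx0 mulmx0 mul0mx addr0 block_mx0.
Qed.

(** The interleaved direct sum becomes a sum of two compressions, so that all
    later computations only use the five relations between the inclusions. *)
Lemma sp_dsumE k l (A : 'M[R]_(k + k)) (B : 'M[R]_(l + l)) :
  sp_dsum A B = incl1 k l *m A *m sadj (incl1 k l) +
                incl2 k l *m B *m sadj (incl2 k l).
Proof.
have [? [? [? [? ->]]]] := block_mxP A; have [? [? [? [? ->]]]] := block_mxP B.
rewrite sp_dsum_block !sadj_diag !tr_col_mx !trmx1 !trmx0 !mulmx_block.
rewrite !(mul0mx, mulmx0, addr0, add0r).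
rewrite !mul_col_mx !mul_mx_row !(mulmx1, mul1mx, mulmx0, mul0mx).
by rewrite /block_mx !add_col_mx !add_row_mx !add_col_mx !add_row_mx !(addr0, add0r).
Qed.

Lemma incl_decomp k l :
  incl1 k l *m sadj (incl1 k l) + incl2 k l *m sadj (incl2 k l) = 1%:M.
Proof. by rewrite -(sp_dsum1 R k l) sp_dsumE !mulmx1. Qed.

Lemma sadj_incl1_norm k l : `|sadj (incl1 k l)| <= 1.
Proof.
rewrite sadj_diag; apply: mx_norm_le => // i j.
rewrite !mxE; case: splitP => i' _; rewrite !mxE; case: splitP => j' _;
  rewrite !mxE ?normr0 ?ler01//; case: splitP => j'' _;
  by rewrite !mxE ?normr0 ?ler01//; case: eqP => _; rewrite ?normr1 ?normr0.
Qed.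

Lemma sadj_incl2_norm k l : `|sadj (incl2 k l)| <= 1.
Proof.
rewrite sadj_diag; apply: mx_norm_le => // i j.
rewrite !mxE; case: splitP => i' _; rewrite !mxE; case: splitP => j' _;
  rewrite !mxE ?normr0 ?ler01//; case: splitP => j'' _;
  by rewrite !mxE ?normr0 ?ler01//; case: eqP => _; rewrite ?normr1 ?normr0.
Qed.

Lemma mulmx_join m a b c (W1 : 'M[R]_(m, a)) V1 (W2 : 'M[R]_(m, b)) V2
    (E1 : 'M[R]_(c, a)) (D1 : 'M[R]_(a, c)) (E2 : 'M[R]_(c, b)) (D2 : 'M[R]_(b, c)) :
  V1 *m W1 = 1%:M -> V2 *m W2 = 1%:M -> V1 *m W2 = 0 -> V2 *m W1 = 0 ->
  (E1 *m V1 + E2 *m V2) *m (W1 *m D1 + W2 *m D2) = E1 *m D1 + E2 *m D2.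
Proof.
move=> VW1 VW2 V1W2 V2W1; rewrite mulmxDl !mulmxDr !mulmxA.
rewrite -!(mulmxA _ V1) -!(mulmxA _ V2) VW1 VW2 V1W2 V2W1.
by rewrite !mulmx0 !mulmx1 !mul0mx addr0 add0r.
Qed.

(** Symplectic frames of two orthogonal subspaces combine into one of their sum. *)
Lemma frame_join n a b (W1 : 'M[R]_(n + n, a + a)) (W2 : 'M[R]_(n + n, b + b)) :
  sadj W1 *m W1 = 1%:M -> sadj W2 *m W2 = 1%:M -> sadj W1 *m W2 = 0 ->
  let W := W1 *m sadj (incl1 a b) + W2 *m sadj (incl2 a b) in
  sadj W *m W = 1%:M /\ W *m sadj W = W1 *m sadj W1 + W2 *m sadj W2.
Proof.
move=> W11 W22 W12 W.
have W21 : sadj W2 *m W1 = 0.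
  by have := congr1 (@sadj R a b) W12; rewrite sadjM sadjK linear0.
have sW : sadj W = incl1 a b *m sadj W1 + incl2 a b *m sadj W2.
  by rewrite /W linearD /= (sadjM W1) (sadjM W2) !sadjK.
rewrite sW /W; split; rewrite mulmx_join ?incl1K ?incl2K ?incl12 ?incl21//.
exact: incl_decomp.
Qed.

Lemma tr_J_skew n (u : 'cV[R]_(n + n)) : u^T *m J R n *m u = 0.
Proof.
have E : (u^T *m J R n *m u)^T = - (u^T *m J R n *m u).
  by rewrite !trmx_mul trmxK JtrE mulNmx mulmxN mulmxA.
move: (u^T *m J R n *m u) E => A E; apply/matrixP => i j; rewrite !ord1.
have := congr1 (fun M : 'M[R]_1 => M 0 0) E; rewrite !mxE => /eqP.
by rewrite -addr_eq0 -mulr2n mulrn_eq0 /= => /eqP ->.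
Qed.

(** For a unit vector u in the range of P, the vector v = P J^T u satisfies
    omega_0(u, v) = u^T J P J^T u = (P u)^T J J^T u = |u|^2.  So v never
    degenerates, and it is bounded in terms of |P|: the bound is what makes the
    orbit map proper later. *)
Lemma hyperbolic_pair n (P : 'M[R]_(n + n)) :
  P *m P = P -> sadj P = P -> P != 0 ->
  exists W : 'M[R]_(n + n, 1 + 1),
    [/\ sadj W *m W = 1%:M, P *m W = W &
        `|W| <= 1 + (n + n)%:R * `|P| * ((n + n)%:R * `|(J R n)^T|)].
Proof.
move=> PP sP P0.
have PJ := sadj_fixE sP.
have [j Pj] : exists j, col j P != 0.
  have [j Pj|Pz] := pickP (fun j => col j P != 0); first by exists j.
  case/eqP: P0; apply/matrixP => i j; have /negbFE/eqP/matrixP/(_ i 0) := Pz j.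
  by rewrite !mxE.
pose u : 'cV[R]_(n + n) := `|col j P|^-1 *: col j P.
have u0 : `|col j P| != 0 by rewrite normr_eq0.
have Pu : P *m u = u by rewrite /u -scalemxAr colE mulmxA PP.
have u1 : `|u| = 1 by rewrite normrZ normfV normr_id mulVf.
(* u is normalized for the max norm, so its Euclidean square s is at least 1. *)
pose s := (u^T *m u) 0 0.
have uu : u^T *m u = s%:M by apply/matrixP => a b; rewrite !ord1 [RHS]mxE mulr1n.
have s1 : 1 <= s.
  have [|i ui] := @mx_norm_neq0 R _ _ u.
    by rewrite -[mx_norm u]/`|u| u1 oner_neq0.
  have {}ui : `|u i.1 i.2| = 1 by rewrite -ui -[mx_norm u]/`|u| u1.
  have -> : s = \sum_k u k 0 ^+ 2.
    by rewrite /s mxE; apply: eq_bigr => k _; rewrite [u^T _ _]mxE expr2.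
  move: ui; rewrite (ord1 i.2) (bigD1 i.1)//= => ui.
  by rewrite -real_normK ?num_real// ui expr1n lerDl sumr_ge0// => k _; exact: sqr_ge0.
have s0 : s != 0 by rewrite gt_eqF// (lt_le_trans ltr01).
pose v : 'cV[R]_(n + n) := s^-1 *: (P *m ((J R n)^T *m u)).
have uv : u^T *m J R n *m v = 1%:M.
  rewrite /v -scalemxAr !mulmxA -(mulmxA _ (J R n)) -PJ mulmxA -trmx_mul Pu.
  by rewrite -(mulmxA u^T) JJtr mulmx1 uu scale_scalar_mx mulVf.
have vu : v^T *m J R n *m u = - 1%:M.
  have := congr1 trmx uv; rewrite !trmx_mul trmxK trmx1 JtrE mulNmx mulmxN mulmxA.
  by move/eqP; rewrite eqr_oppLR => /eqP.
exists (row_mx u v); split.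
- rewrite mul_sadj_J tr_row_mx mul_col_mx mul_col_row !tr_J_skew uv vu.
  by rewrite -/(J R 1) JtrJ.
- by rewrite mul_mx_row Pu /v -scalemxAr (mulmxA P P) PP.
have b0 : 0 <= (n + n)%:R * `|P| * ((n + n)%:R * `|(J R n)^T|) by rewrite !mulr_ge0.
apply: mx_norm_le => [|a b]; first by rewrite addr_ge0.
rewrite mxE; case: splitP => b' _; rewrite (le_trans (mx_norm_entry _ _ _))//.
  by rewrite u1 lerDl.
rewrite /v normrZ (@le_trans _ _ `|P *m ((J R n)^T *m u)|)//.
  rewrite ler_piMl// normfV invf_le1 ?normr_gt0// ger0_norm//.
  by rewrite (le_trans ler01).
rewrite (le_trans (mx_norm_mul _ _))// ler_wpDl// ler_wpM2l ?mulr_ge0//.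
by rewrite (le_trans (mx_norm_mul _ _))// u1 mulr1.

Qed.

End SymplecticFrames.

(** * Transitivity and stabilizer *)

Section Transitivity.
Variable R : realType.

Lemma sadj_norm a b : exists2 K : R, 0 <= K &
  forall A : 'M[R]_(a + a, b + b), `|sadj A| <= K * `|A|.
Proof.
have [K K0 HK] := linear_lipschitz (@mx_linear_continuous R _ _ _ (@sadj R a b)).
by exists K; first exact: ltW.
Qed.

(** Removing from P the projection on a symplectic frame of a subspace of its
    range leaves the projection on the orthogonal complement within that range. *)
Lemma frame_peel n a (P : 'M[R]_(n + n)) (W : 'M[R]_(n + n, a + a)) :
  P *m P = P -> sadj P = P -> sadj W *m W = 1%:M -> P *m W = W ->
  let Q := P - W *m sadj W in
  [/\ Q *m Q = Q, sadj Q = Q, sadj W *m Q = 0, Q *m W = 0 & Q *m P = Q].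
Proof.
move=> PP sP WW PW Q.
have WP : sadj W *m P = sadj W by rewrite -[in LHS]sP -(sadjM P) PW.
have QW : Q *m W = 0 by rewrite mulmxBl PW -mulmxA WW mulmx1 subrr.
have WQ : sadj W *m Q = 0 by rewrite mulmxBr WP mulmxA WW mul1mx subrr.
have QP : Q *m P = Q by rewrite mulmxBl PP -mulmxA WP.
split=> //; first by rewrite {2}/Q mulmxBr QP mulmxA QW mul0mx subr0.
by rewrite /Q linearB /= sP (sadjM W) sadjK.
Qed.

(** Induction on the rank, peeling off one hyperbolic pair at a time.  The
    constant depends only on n, the rank and the bound on |P|, since each step
    bounds the pair, hence the norm of the remaining projection. *)
Lemma exists_symplectic_frame n r (c : R) : exists C, forall P : 'M[R]_(n + n),
  P *m P = P -> sadj P = P -> (\rank P <= r)%N -> `|P| <= c ->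
  exists m (W : 'M[R]_(n + n, m + m)),
    [/\ sadj W *m W = 1%:M, W *m sadj W = P & `|W| <= C].
Proof.
have zero_frame (P : 'M[R]_(n + n)) C : P = 0 -> 0 <= C ->
    exists m (W : 'M[R]_(n + n, m + m)),
    [/\ sadj W *m W = 1%:M, W *m sadj W = P & `|W| <= C].
  move=> -> C0; exists 0%N, 0; rewrite linear0 !mul0mx normr0; split=> //.
  by apply/matrixP => -[].
elim: r c => [|r IH] c.
  exists 0 => P _ _; rewrite leqn0 mxrank_eq0 => /eqP P0 _; exact: zero_frame.
have [K K0 HK] := sadj_norm n 1.
pose N : R := (n + n)%:R; pose c1 := 1 + N * c * (N * `|(J R n)^T|).
have [C HC] := IH (c + 2 * c1 * (K * c1)).
exists (Num.max 0 (2 * c1 + N * C)) => P PP sP rP Pc.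
have [P0|P0] := eqVneq P 0; first by apply: zero_frame => //; rewrite le_max lexx.
have [W1 [WW1 PW1 W1c]] := hyperbolic_pair PP sP P0.
have {}W1c : `|W1| <= c1.
  by rewrite (le_trans W1c)// lerD2l ler_wpM2r ?mulr_ge0// ler_wpM2l.
have c10 : 0 <= c1 by rewrite (le_trans (normr_ge0 _) W1c).
have [QQ sQ W1Q QW1 QP] := frame_peel PP sP WW1 PW1.
set Q := P - _ in QQ sQ W1Q QW1 QP.
(* The rank drops strictly: Q = Q P, but P = D Q would give W1 = P W1 = D Q W1 = 0. *)
have rQ : (\rank Q <= r)%N.
  rewrite -ltnS (leq_trans _ rP)// rank_ltmx// /ltmx -{1}QP submxMl /=.
  apply/negP => /submxP[D PD].
  have W10 : W1 = 0 by rewrite -PW1 PD -mulmxA QW1 mulmx0.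
  have := WW1; rewrite W10 mulmx0 => /matrixP/(_ 0 0)/eqP.
  by rewrite !mxE /= eq_sym oner_eq0.
have Qc : `|Q| <= c + 2 * c1 * (K * c1).
  rewrite (le_trans (ler_normB _ _))// lerD// (le_trans (mx_norm_mul _ _))//.
  rewrite ler_pM ?mulr_ge0// ?ler_wpM2l// (le_trans (HK _))// ler_wpM2l//.
have [m [W2 [WW2 W2Q W2C]]] := HC _ QQ sQ rQ Qc.
have W12 : sadj W1 *m W2 = 0.
  by rewrite -[W2]mulmx1 -WW2 (mulmxA W2) W2Q mulmxA W1Q mul0mx.
have [h1 h2] := frame_join WW1 WW2 W12.
exists (1 + m)%N, (W1 *m sadj (incl1 R 1 m) + W2 *m sadj (incl2 R 1 m)).
split=> //; first by rewrite h2 W2Q addrC subrK.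
rewrite le_max; apply/orP; right.
have C0 : 0 <= C by rewrite (le_trans (normr_ge0 _) W2C).
rewrite (le_trans (ler_normD _ _))// lerD// (le_trans (mx_norm_mul _ _))//.
  by rewrite -[leRHS]mulr1 ler_pM ?mulr_ge0 ?sadj_incl1_norm// ler_wpM2l.
rewrite -[leRHS]mulr1 ler_pM ?mulr_ge0 ?sadj_incl2_norm// ler_pM//.
by rewrite ler_nat (mulmx1_min WW2).
Qed.

Lemma frame_trace n m (W : 'M[R]_(n + n, m + m)) :
  sadj W *m W = 1%:M -> \tr (W *m sadj W) = (m + m)%:R.
Proof. by move=> WW; rewrite mxtrace_mulC WW mxtrace1. Qed.

Lemma frame_rank n m (W : 'M[R]_(n + n, m + m)) :
  sadj W *m W = 1%:M -> \rank (W *m sadj W) = (m + m)%N.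
Proof.
move=> WW; rewrite mxrankMfree; last by apply/row_freeP; exists W.
apply/eqP; rewrite eqn_leq rank_leq_col /=.
by have := mxrankM_maxr (sadj W) W; rewrite WW mxrank1.
Qed.

Definition base k l := incl1 R k l *m sadj (incl1 R k l).

(** Frames of the ranges of P and of 1 - P together form a symplectic matrix g
    that carries the base projection to P.  Traces give the size of the second
    frame. *)
Lemma sp_transitive k l (c : R) : exists C, forall P : 'M[R]_((k + l) + (k + l)),
  SpGr R (k + l) k P -> `|P| <= c ->
  exists g, [/\ Sp R (k + l) g, g *m base k l *m sadj g = P & `|g| <= C].
Proof.
set n := (k + l)%N.
have [C1 H1] := @exists_symplectic_frame n (n + n) c.
have [C2 H2] := @exists_symplectic_frame n (n + n) (`|1%:M : 'M[R]_(n + n)| + c).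
exists ((k + k)%:R * C1 + (l + l)%:R * C2) => P [PP rP sP] Pc.
have [m1 [W1 [WW1 W1P W1C]]] := H1 _ PP sP (rank_leq_row _) Pc.
have m1k : m1 = k.
  by have := frame_rank WW1; rewrite W1P rP mul2n addnn => /double_inj.
subst m1; pose Q := 1%:M - P.
have QQ : Q *m Q = Q.
  by rewrite /Q mulmxBl mul1mx mulmxBr mulmx1 PP subrr subr0.
have sQ : sadj Q = Q by rewrite /Q linearB /= sadj1 sP.
have Qc : `|Q| <= `|1%:M : 'M[R]_(n + n)| + c.
  by rewrite (le_trans (ler_normB _ _))// lerD.
have [m2 [W2 [WW2 W2Q W2C]]] := H2 _ QQ sQ (rank_leq_row _) Qc.
have m2l : m2 = l.
  have : \tr (1%:M : 'M[R]_(n + n)) = \tr P + \tr Q.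
    by rewrite -mxtraceD /Q addrC subrK.
  rewrite mxtrace1 -W1P -W2Q !frame_trace// -natrD => /eqP; rewrite eqr_nat.
  by rewrite /n => /eqP; lia.
subst m2.
have W12 : sadj W1 *m W2 = 0.
  have VP : sadj W1 *m P = sadj W1 by rewrite -W1P (mulmxA (sadj W1) W1) WW1 mul1mx.
  have VQ : sadj W1 *m Q = 0 by rewrite mulmxBr mulmx1 VP subrr.
  by rewrite -[W2]mulmx1 -WW2 (mulmxA W2 (sadj W2) W2) W2Q (mulmxA (sadj W1) Q) VQ mul0mx.
have [h1 h2] := frame_join WW1 WW2 W12.
set g := W1 *m _ + _ in h1 h2.
exists g; split=> //.
  have gE : g *m incl1 R k l = W1.
    by rewrite mulmxDl -(mulmxA W1) -(mulmxA W2) incl1K incl21 mulmx1 mulmx0 addr0.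
  by rewrite /base (mulmxA g) gE -(mulmxA W1) -(sadjM g) gE.
have C10 : 0 <= C1 by rewrite (le_trans (normr_ge0 _) W1C).
have C20 : 0 <= C2 by rewrite (le_trans (normr_ge0 _) W2C).
rewrite (le_trans (ler_normD _ _))// lerD// (le_trans (mx_norm_mul _ _))//.
  by rewrite -[leRHS]mulr1 ler_pM ?mulr_ge0 ?sadj_incl1_norm// ler_wpM2l.
by rewrite -[leRHS]mulr1 ler_pM ?mulr_ge0 ?sadj_incl2_norm// ler_wpM2l.
Qed.

Lemma baseE k l : base k l = sp_dsum 1%:M 0.
Proof. by rewrite sp_dsumE mulmx1 mulmx0 mul0mx addr0. Qed.

(** Compression by E is multiplicative on matrices commuting with E E^+. *)
Lemma sp_compress a b (g : 'M[R]_(a + a)) (E : 'M[R]_(a + a, b + b)) :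
  Sp R a g -> sadj E *m E = 1%:M -> g *m (E *m sadj E) = E *m sadj E *m g ->
  Sp R b (sadj E *m g *m E) /\
  E *m (sadj E *m g *m E) *m sadj E = g *m (E *m sadj E).
Proof.
rewrite /Sp /= => Sg; rewrite (sadjM (_ *m _)) (sadjM (sadj E)) sadjK.
move: (sadj g) (sadj E) Sg => h D hg DE c; split.
  rewrite (_ : _ *m _ = D *m h *m (E *m D *m g) *m E); last by rewrite !mulmxA.
  by rewrite -c !mulmxA -(mulmxA D) hg mulmx1 -!mulmxA DE !mulmx1.
rewrite (_ : _ *m _ = E *m D *m g *m (E *m D)); last by rewrite !mulmxA.
by rewrite -c -mulmxA (mulmxA _ E) -(mulmxA E) DE mulmx1.
Qed.

(** g commutes with both E E^+ and F F^+, hence is the sum of its two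
    compressions. *)
Lemma sp_stabilizer k l (g : 'M[R]_((k + l) + (k + l))) :
  Sp R (k + l) g -> g *m base k l = base k l *m g ->
  exists A B, [/\ Sp R k A, Sp R l B & g = sp_dsum A B].
Proof.
move=> Sg gc; have dec := incl_decomp R k l; rewrite -/(base k l) in dec.
have FF : incl2 R k l *m sadj (incl2 R k l) = 1%:M - base k l.
  by rewrite -dec [base k l + _]addrC addrK.
have gc2 : g *m (incl2 R k l *m sadj (incl2 R k l)) =
           incl2 R k l *m sadj (incl2 R k l) *m g.
  by rewrite FF mulmxBr mulmxBl mulmx1 mul1mx gc.
have [SA EA] := sp_compress Sg (incl1K R k l) gc.
have [SB EB] := sp_compress Sg (incl2K R k l) gc2.
exists (sadj (incl1 R k l) *m g *m incl1 R k l),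
       (sadj (incl2 R k l) *m g *m incl2 R k l); split=> //.
by rewrite sp_dsumE EA EB -mulmxDr -/(base k l) dec mulmx1.
Qed.

End Transitivity.

(** * Cayley charts of the symplectic group *)

Section SymplecticGroup.
Variables (R : realType) (n : nat).
Local Notation M := 'M[R]_(n + n).

(** The Lie algebra of Sp(2n).  Its dimension is left implicit, as only a basis
    is used. *)
Definition hamiltonian : {vspace M} := lker (linfun (fun X : M => sadj X + X)).

Lemma hamiltonianP (X : M) : reflect (sadj X = - X) (X \in hamiltonian).
Proof.
have l : linear (fun X : M => sadj X + X).
  by move=> a A B; rewrite linearP scalerDr addrACA.
pose L : {linear M -> M} := HB.pack (fun X : M => sadj X + X)
  (GRing.isLinear.Build _ _ _ _ _ l).
rewrite memv_ker -[fun X => _]/(L : M -> M) lfunE /= addr_eq0.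
exact: eqP.
Qed.

Local Notation d := (\dim hamiltonian).

Definition ham_coord (X : M) : 'rV[R]_d := \row_i coord (vbasis hamiltonian) i X.

Definition ham_of (v : 'rV[R]_d) : M := \sum_i v 0 i *: (vbasis hamiltonian)`_i.

Lemma ham_coord_is_linear : linear ham_coord.
Proof. by move=> a A B; apply/rowP => i; rewrite !mxE linearP. Qed.

Lemma ham_of_is_linear : linear ham_of.
Proof.
move=> a u v; rewrite /ham_of scaler_sumr -big_split; apply: eq_bigr => i _ /=.
by rewrite !mxE scalerDl scalerA.
Qed.

HB.instance Definition _ := GRing.isLinear.Build _ _ _ _ ham_coord ham_coord_is_linear.
HB.instance Definition _ := GRing.isLinear.Build _ _ _ _ ham_of ham_of_is_linear.

Lemma ham_ofP v : sadj (ham_of v) = - ham_of v.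
Proof.
apply/hamiltonianP; apply: memv_suml => i _; apply: memvZ.
by apply: vbasis_mem; apply: mem_nth; rewrite size_tuple.
Qed.

Lemma ham_coordK (X : M) : sadj X = - X -> ham_of (ham_coord X) = X.
Proof.
move=> /hamiltonianP HX; rewrite [RHS](coord_vbasis HX).
by apply: eq_bigr => i _; rewrite mxE.
Qed.

Lemma ham_ofK : cancel ham_of ham_coord.
Proof.
move=> v; apply/rowP => i; rewrite mxE coord_sum_free//.
exact: basis_free (vbasisP _).
Qed.

Definition cayley (X : M) : M := (1%:M - X) *m invmx (1%:M + X).

Lemma add1_cayley X : 1%:M + X \in unitmx -> 1%:M + cayley X = 2 *: invmx (1%:M + X).
Proof.
move=> uX; rewrite -{1}(mulmxV uX) /cayley -mulmxDl addrACA subrr addr0.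
by rewrite mulmxDl mul1mx scaler_nat mulr2n.
Qed.

Lemma sub1_cayley X : 1%:M + X \in unitmx ->
  1%:M - cayley X = 2 *: (X *m invmx (1%:M + X)).
Proof.
move=> uX; rewrite -{1}(mulmxV uX) /cayley -mulmxBl opprB (addrC 1%:M) addrACA subrr addr0.
by rewrite mulmxDl (addrC X) scaler_nat mulr2n.
Qed.

Lemma cayley_unit X : 1%:M + X \in unitmx -> 1%:M + cayley X \in unitmx.
Proof.
by move=> uX; rewrite add1_cayley// unitmxZ ?unitmx_inv// unitfE pnatr_eq0.
Qed.

(** With Y = (1 + X)^-1 and N = cayley X one has 1 + N = 2 Y and 1 - N = 2 X Y,
    so (1 - N)(1 + N)^-1 = X: the Cayley transform is its own inverse. *)
Lemma cayleyK X : 1%:M + X \in unitmx -> cayley (cayley X) = X.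
Proof.
move=> uX; rewrite {1}/cayley add1_cayley// sub1_cayley//.
rewrite invmxZ; last by rewrite unitmxZ ?unitmx_inv// unitfE pnatr_eq0.
by rewrite invmxK -scalemxAl -scalemxAr scalerA mulmxKV// divff ?pnatr_eq0// scale1r.
Qed.

Lemma sadj_inv (A : M) : A \in unitmx ->
  sadj A \in unitmx /\ sadj (invmx A) = invmx (sadj A).
Proof.
move=> uA; have E : sadj (invmx A) *m sadj A = 1%:M.
  by rewrite -(sadjM A) mulmxV// sadj1.
have [_ u] := mulmx1_unit E; split=> //.
by rewrite -[LHS]mulmx1 -(mulmxV u) mulmxA E mul1mx.
Qed.

Lemma sub1_ham_unit (X : M) : sadj X = - X -> 1%:M + X \in unitmx -> 1%:M - X \in unitmx.
Proof. by move=> hX /sadj_inv[]; rewrite linearD /= sadj1 hX. Qed.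

Lemma cayley_Sp (X : M) : sadj X = - X -> 1%:M + X \in unitmx -> Sp R n (cayley X).
Proof.
move=> hX uX; have uX' := sub1_ham_unit hX uX.
have [_ si] := sadj_inv uX.
rewrite /Sp /= /cayley (sadjM (1%:M - X)) si linearD linearB /= sadj1 hX opprK.
have c : (1%:M + X) *m (1%:M - X) = (1%:M - X) *m (1%:M + X).
  by rewrite !mulmxDr !mulmxDl !mul1mx !mulmx1 mulmxN mulNmx addrACA.
by rewrite -mulmxA (mulmxA (1%:M + X)) c -!mulmxA mulmxV// mulmx1 mulVmx.
Qed.

(** For symplectic N the adjoint N^+ is the inverse of N, and
    (1 - N^-1)(1 + N^-1)^-1 = (N - 1)(N + 1)^-1. *)
Lemma cayley_ham N : Sp R n N -> 1%:M + N \in unitmx -> sadj (cayley N) = - cayley N.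
Proof.
rewrite /Sp /= => SN uN; have [uN' si] := sadj_inv uN.
move: uN' si; rewrite /cayley (sadjM (1%:M - N)) => uN' ->.
move: uN'; rewrite linearD linearB /= sadj1; move: (sadj N) SN => N' N'N uN'.
have NN' : N *m N' = 1%:M by exact: mulmx1C.
have -> : 1%:M - N' = (1%:M + N') *m - ((1%:M - N) *m invmx (1%:M + N)).
  apply: (can_inj (mulmxK uN)).
  rewrite mulmxN mulNmx -!mulmxA mulVmx// mulmx1.
  rewrite !(mulmxBl, mulmxDl, mulmxBr, mulmxDr) !(mul1mx, mulmx1) N'N.
  by rewrite (addrC N') [1%:M - N + _]addrC opprD addrACA subrr add0r subrKA opprB.
by rewrite mulKmx.
Qed.

Definition sp_chart (M0 : M) : ambient_chart R (n + n) (n + n) d :=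
  AmbientChart [set A | 1%:M + sadj M0 *m A \in unitmx]
    (fun A => ham_coord (cayley (sadj M0 *m A)))
    [set v | 1%:M + ham_of v \in unitmx]
    (fun v => M0 *m cayley (ham_of v)).

Lemma open_cayley_dom : open [set X : M | 1%:M + X \in unitmx].
Proof.
apply: open_unitmx => X; apply: (@continuousD R M M (cst 1%:M) id).
  exact: cst_continuous.
exact: cvg_id.
Qed.

Lemma cayley_smooth : smooth_on [set X | 1%:M + X \in unitmx] cayley.
Proof.
move=> k; have oU := open_cayley_dom; apply: Ck_on_mul => //.
  apply: Ck_on_add => //; first exact: Ck_on_cst.
  by apply: Ck_on_opp => //; exact: Ck_on_id.
apply: Ck_on_inv => //; apply: Ck_on_add => //; first exact: Ck_on_cst.
exact: Ck_on_id.
Qed.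

Lemma open_linear_preimage m p (l : {linear 'M[R]_(m, p) -> M}) (U : set M) :
  open U -> open (l @^-1` U).
Proof. by move=> oU; apply: open_comp => // x _; exact: mx_linear_continuous. Qed.

Lemma sp_chart_ambient M0 : Sp R n M0 -> is_ambient_chart (Sp R n) (sp_chart M0).
Proof.
move=> SM0.
have oD : open (amb_dom (sp_chart M0)).
  exact: (@open_linear_preimage _ _ (mulmx (sadj M0)) _ open_cayley_dom).
have oC : open (amb_cod (sp_chart M0)).
  exact: (@open_linear_preimage _ _ ham_of _ open_cayley_dom).
split=> //.
- move=> k; apply: Ck_on_linear_comp => //; first exact: mx_linear_continuous.
  apply: (Ck_on_comp _ _ _ (@cayley_smooth k)) => //.
  exact: (@Ck_on_linear R _ _ _ k _ (mulmx (sadj M0))).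
- move=> k; apply: Ck_on_mul => //; first exact: Ck_on_cst.
  apply: (Ck_on_comp _ _ _ (@cayley_smooth k)) => //.
  exact: (@Ck_on_linear R _ _ _ k _ ham_of oC).
- move=> A SA /= uA; have SN : Sp R n (sadj M0 *m A) by apply: SpM => //; exact: Sp_sadj.
  have hC := cayley_ham SN uA; rewrite ham_coordK//; split; first exact: cayley_unit.
  by rewrite cayleyK// mulmxA Sp_mulr// mul1mx.
- move=> v /= uv; have SC := cayley_Sp (ham_ofP v) uv.
  have M01 : sadj M0 *m (M0 *m cayley (ham_of v)) = cayley (ham_of v).
    by rewrite mulmxA [sadj M0 *m M0]SM0 mul1mx.
  split; first exact: SpM.
    by rewrite M01; exact: cayley_unit.
  by rewrite M01 cayleyK// ham_ofK.
Qed.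

Lemma sp_chart_cover A : Sp R n A -> amb_dom (sp_chart A) A.
Proof.
move=> SA; rewrite /= [sadj A *m A]SA -mulr2n -scaler_nat unitmxZ ?unitmx1//.
by rewrite unitfE pnatr_eq0.
Qed.

(** The tangent space of Sp(2n) at M consists of the matrices M X with X
    Hamiltonian.  Differentiating M0 (1 - Z)(1 + Z)^-1 in the direction W gives
    -2 M0 (1 + Z)^-1 W (1 + Z)^-1; solving for W gives the direction used here,
    which is again Hamiltonian. *)
Lemma sp_chart_velocity M0 v X : 1%:M + ham_of v \in unitmx -> sadj X = - X ->
  exists w, 'D_w (amb_inv (sp_chart M0)) v = amb_inv (sp_chart M0) v *m X.
Proof.
move=> uv hX; have oU := open_cayley_dom.
have uv' := sub1_ham_unit (ham_ofP v) uv.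
pose W : M := - 2^-1 *: ((1%:M - ham_of v) *m X *m (1%:M + ham_of v)).
have hW : sadj W = - W.
  rewrite linearZ /= (sadjM (_ *m X)) (sadjM (_ - _)) linearD linearB /= sadj1 ham_ofP opprK.
  by rewrite hX mulNmx mulmxN scalerN mulmxA.
exists (ham_coord W).
have hc : continuous (ham_of : 'rV_d -> M) := @mx_linear_continuous R 1 d M ham_of.
have dh : differentiable ham_of v := @linear_differentiable R _ _ ham_of v hc.
have Dh : 'D_(ham_coord W) ham_of v = W.
  by rewrite (@derive_linear R _ _ ham_of v (ham_coord W) hc) /= ham_coordK.
have c1 : differentiable (fun=> 1%:M : M) v by exact: differentiable_cst.
have dP : differentiable (fun u => 1%:M + ham_of u) v by exact: differentiableD.
have DP : 'D_(ham_coord W) (fun u => 1%:M + ham_of u) v = W.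
  rewrite (@deriveD _ _ _ (fun=> 1%:M) ham_of); last exact: diff_derivable.
    by rewrite derive_cst add0r.
  exact: diff_derivable.
have dm : differentiable (fun u => 1%:M - ham_of u) v by exact: differentiableB.
have Dm : 'D_(ham_coord W) (fun u => 1%:M - ham_of u) v = - W.
  rewrite (@deriveB _ _ _ (fun=> 1%:M) ham_of); last exact: diff_derivable.
    by rewrite derive_cst sub0r Dh.
  exact: diff_derivable.
have [dI DI] := derive_invmx (ham_coord W) dP uv.
have [dC DC] := derive_mulmx (ham_coord W) dm dI.
have [_ ->] := derive_mulmx (ham_coord W) (differentiable_cst M0 v) dC.
rewrite DC DI Dm DP derive_cst mul0mx addr0 -[RHS]mulmxA; congr (M0 *m _). rewrite /=.
rewrite /cayley -mulmxA; set Y := invmx _; set B := 1%:M - _.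
have WY : W *m Y = - 2^-1 *: (B *m X) by rewrite -scalemxAl mulmxK.
have YB : Y *m B = 2 *: Y - 1%:M.
  have -> : B = 2 *: 1%:M - (1%:M + ham_of v).
    by rewrite /B scaler_nat mulr2n opprD addrACA subrr add0r.
  by rewrite mulmxBr -scalemxAr mulmx1 mulVmx.
clearbody B Y.
rewrite mulNmx -[RHS]mulmxA WY scaleNr !mulmxN !opprK -!scalemxAr -scalerDr.
rewrite (mulmxA Y) YB mulmxBl mul1mx mulmxBr subrK -scalemxAl -scalemxAr scalerA.
by rewrite mulVf ?pnatr_eq0// scale1r.
Qed.

End SymplecticGroup.

(** * Graph charts of the symplectic Grassmannian *)

Section GraphCharts.
Variables (R : realType) (k l : nat).
Local Notation n := (k + l)%N.
Local Notation E := (incl1 R k l).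
Local Notation F := (incl2 R k l).
Implicit Types (A : 'M[R]_(l + l, k + k)) (P Q g : 'M[R]_(n + n)).

(** The matrix whose column space is the graph of A over the first summand. *)
Definition graph A : 'M[R]_(n + n, k + k) := E + F *m A.
Definition gram A : 'M[R]_(k + k) := 1%:M + sadj A *m A.
Definition graph_proj A := graph A *m invmx (gram A) *m sadj (graph A).
Definition corner Q := sadj E *m Q *m E.
Definition slope Q := sadj F *m Q *m E *m invmx (corner Q).

Lemma incl1_graph A : sadj E *m graph A = 1%:M.
Proof. by rewrite mulmxDr (mulmxA (sadj E) F) incl1K incl12 mul0mx addr0. Qed.

Lemma incl2_graph A : sadj F *m graph A = A.
Proof. by rewrite mulmxDr (mulmxA (sadj F) F) incl2K incl21 mul1mx add0r. Qed.

Lemma sadj_graph A : sadj (graph A) = sadj E + sadj A *m sadj F.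
Proof. by rewrite linearD /= (sadjM F). Qed.

Lemma sadj_graph_incl1 A : sadj (graph A) *m E = 1%:M.
Proof.
by rewrite sadj_graph mulmxDl -(mulmxA (sadj A)) incl1K incl21 mulmx0 addr0.
Qed.

Lemma graph_gram A : sadj (graph A) *m graph A = gram A.
Proof.
by rewrite {1}sadj_graph mulmxDl -(mulmxA (sadj A)) incl1_graph incl2_graph.
Qed.

Lemma sadj_gram A : sadj (gram A) = gram A.
Proof. by rewrite linearD /= sadj1 (sadjM (sadj A)) sadjK. Qed.

Lemma corner_graph_proj A : corner (graph_proj A) = invmx (gram A).
Proof.
rewrite /corner /graph_proj; have := sadj_graph_incl1 A; have := incl1_graph A.
move: (sadj E) (sadj (graph A)) => D G DG GE.
by rewrite !mulmxA DG mul1mx -mulmxA GE mulmx1.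
Qed.

Lemma slope_graph_proj A : gram A \in unitmx -> slope (graph_proj A) = A.
Proof.
move=> uA; rewrite /slope corner_graph_proj invmxK /graph_proj.
have := sadj_graph_incl1 A; have := incl2_graph A.
move: (sadj F) (sadj (graph A)) => D G DG GE.
by rewrite !mulmxA DG -(mulmxA _ G) GE mulmx1 mulmxKV.
Qed.

Lemma rank_corner Q : corner Q \in unitmx -> (k + k <= \rank Q)%N.
Proof.
move=> /mxrank_unit <-; rewrite /corner (leq_trans (mxrankM_maxl _ _))//.
exact: mxrankM_maxr.
Qed.

Lemma graph_proj_SpGr A : gram A \in unitmx -> SpGr R n k (graph_proj A).
Proof.
move=> uA; have uI : invmx (gram A) \in unitmx by rewrite unitmx_inv.
have [_ sI] := sadj_inv uA; rewrite sadj_gram in sI.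
split.
- rewrite /graph_proj; have := graph_gram A; move: (sadj (graph A)) => G GG.
  by rewrite !mulmxA -(mulmxA _ G) GG mulmxKV.
- apply/eqP; rewrite mul2n -addnn eqn_leq rank_corner ?corner_graph_proj// andbT.
  by rewrite (leq_trans (mxrankM_maxr _ _))// rank_leq_row.
- rewrite /graph_proj (sadjM (_ *m _)) (sadjM (graph A)) sadjK sI.
  by rewrite mulmxA.
Qed.

Lemma graph_slope Q : corner Q \in unitmx ->
  graph (slope Q) = Q *m E *m invmx (corner Q).
Proof.
move=> uQ; rewrite -[RHS]mul1mx -(incl_decomp R k l) mulmxDl /graph /slope.
congr (_ + _).
  have -> : E *m sadj E *m (Q *m E *m invmx (corner Q)) =
            E *m (corner Q *m invmx (corner Q)).
    by rewrite /corner; move: (sadj E) (invmx _) => D I; rewrite !mulmxA.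
  by rewrite mulmxV// mulmx1.
by move: (sadj F) => D; rewrite !mulmxA.
Qed.

(** Both Q and the projection Q' on the graph have rank 2k, and Q Q' = Q' = Q' Q,
    so they coincide.  The Gram matrix of the slope is the inverse of the corner. *)
Lemma graph_proj_slope Q : SpGr R n k Q -> corner Q \in unitmx ->
  gram (slope Q) \in unitmx /\ graph_proj (slope Q) = Q.
Proof.
move=> [QQ rQ sQ] uQ; have gE := graph_slope uQ.
have sc : sadj (corner Q) = corner Q.
  by rewrite /corner (sadjM (sadj E *m Q)) (sadjM (sadj E)) sadjK sQ mulmxA.
have [_ sI] := sadj_inv uQ; rewrite sc in sI.
have sgE : sadj (graph (slope Q)) = invmx (corner Q) *m (sadj E *m Q).
  by rewrite gE (sadjM (_ *m _)) (sadjM Q) sI sQ.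
have grE : gram (slope Q) = invmx (corner Q).
  rewrite -graph_gram sgE gE.
  have -> : invmx (corner Q) *m (sadj E *m Q) *m (Q *m E *m invmx (corner Q)) =
            invmx (corner Q) *m (sadj E *m (Q *m Q) *m E) *m invmx (corner Q).
    by move: (sadj E) (invmx _) => D I; rewrite !mulmxA.
  by rewrite QQ -/(corner Q) mulVmx// mul1mx.
have ug : gram (slope Q) \in unitmx by rewrite grE unitmx_inv.
split=> //; set Q' := graph_proj _.
have [Q'Q' rQ' _] := graph_proj_SpGr ug; rewrite -/Q' in Q'Q' rQ'.
have QQ' : Q *m Q' = Q'.
  rewrite /Q' /graph_proj; move: (invmx (gram _)) (sadj (graph _)) => I D.
  rewrite gE; move: (invmx (corner Q)) => I'.
  by rewrite !mulmxA QQ.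
have Q'Q : Q' *m Q = Q'.
  rewrite /Q' /graph_proj sgE; move: (invmx (gram _)) (graph _) => I G.
  move: (invmx (corner Q)) (sadj E) => I' D.
  by rewrite -!mulmxA QQ.
have : (Q <= Q')%MS.
  have Q'leQ : (Q' <= Q)%MS by rewrite -Q'Q submxMl.
  by rewrite -(mxrank_leqif_sup Q'leQ).2 rQ rQ'.
move=> /submxP[D QD].
by rewrite -[LHS]QQ' {1}QD -mulmxA Q'Q' -QD.
Qed.

Lemma orbit_corner N : corner (N *m base R k l *m sadj N) =
  corner N *m sadj (corner N).
Proof.
rewrite /corner /base (sadjM (sadj E *m N)) (sadjM (sadj E)) sadjK.
by move: (sadj E) (sadj N) => D N'; rewrite !mulmxA.
Qed.

Lemma orbit_corner_unit N :
  (corner (N *m base R k l *m sadj N) \in unitmx) = (corner N \in unitmx).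
Proof.
rewrite orbit_corner unitmx_mul; have [u|//] := boolP (corner N \in unitmx).
by have [->] := sadj_inv u.
Qed.

(** The range of N E E^+ N^+ is the column space of N E, so its slope can be read
    off the two blocks of N E; the common factor (E^+ N E)^+ cancels. *)
Lemma orbit_slope N : corner N \in unitmx ->
  slope (N *m base R k l *m sadj N) = sadj F *m N *m E *m invmx (corner N).
Proof.
move=> u; have [u' _] := sadj_inv u; rewrite /slope orbit_corner.
have -> : sadj F *m (N *m base R k l *m sadj N) *m E =
          sadj F *m N *m E *m sadj (corner N).
  rewrite /corner /base (sadjM (sadj E *m N)) (sadjM (sadj E)) sadjK.
  by move: (sadj E) (sadj N) (sadj F) => D N' D'; rewrite !mulmxA.
apply: (can_inj (mulmxK (u : corner N \in unitmx))); rewrite mulmxKV//.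
apply: (can_inj (mulmxK u')); rewrite -mulmxA mulmxKV// unitmx_mul u.
exact: u'.
Qed.

Lemma dim_slope : ((l + l) * (k + k) = 4 * l * k)%N.
Proof. by lia. Qed.

Definition slope_coord A : 'rV[R]_(4 * l * k) :=
  \row_i mxvec A 0 (cast_ord (esym dim_slope) i).

Definition slope_of (v : 'rV[R]_(4 * l * k)) : 'M[R]_(l + l, k + k) :=
  vec_mx (\row_i v 0 (cast_ord dim_slope i)).

Lemma slope_coord_is_linear : linear slope_coord.
Proof. by move=> a A B; apply/rowP => i; rewrite mxE linearP !mxE. Qed.

Lemma slope_of_is_linear : linear slope_of.
Proof.
move=> a u v; rewrite /slope_of -linearP; congr vec_mx.
by apply/rowP => i; rewrite !mxE.
Qed.

HB.instance Definition _ :=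
  GRing.isLinear.Build _ _ _ _ slope_coord slope_coord_is_linear.
HB.instance Definition _ :=
  GRing.isLinear.Build _ _ _ _ slope_of slope_of_is_linear.

Lemma slope_coordK : cancel slope_coord slope_of.
Proof.
move=> A; rewrite -[RHS]mxvecK /slope_of; congr vec_mx.
by apply/rowP => i; rewrite !mxE cast_ordK.
Qed.

Lemma slope_ofK : cancel slope_of slope_coord.
Proof.
by move=> v; apply/rowP => i; rewrite mxE vec_mxK mxE cast_ordKV.
Qed.

Definition gr_chart g : ambient_chart R (n + n) (n + n) (4 * l * k) :=
  AmbientChart [set P | corner (sadj g *m P *m g) \in unitmx]
    (fun P => slope_coord (slope (sadj g *m P *m g)))
    [set v | gram (slope_of v) \in unitmx]
    (fun v => g *m graph_proj (slope_of v) *m sadj g).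

Lemma Ck_on_corner (V : normedModType R) c (U : set V) (f : V -> 'M[R]_(n + n)) :
  open U -> Ck_on c U f -> Ck_on c U (fun x => corner (f x)).
Proof.
move=> oU cf; apply: Ck_on_mul => //; last exact: Ck_on_cst.
by apply: Ck_on_mul => //; exact: Ck_on_cst.
Qed.

Lemma Ck_on_slope (V : normedModType R) c (U : set V) (f : V -> 'M[R]_(n + n)) :
  open U -> (forall x, U x -> corner (f x) \in unitmx) ->
  Ck_on c U f -> Ck_on c U (fun x => slope (f x)).
Proof.
move=> oU fu cf; apply: Ck_on_mul => //; last first.
  by apply: Ck_on_inv => //; exact: Ck_on_corner.
apply: Ck_on_mul => //; last exact: Ck_on_cst.
by apply: Ck_on_mul => //; exact: Ck_on_cst.
Qed.

Lemma Ck_on_sadj (V : normedModType R) a b c (U : set V) (f : V -> 'M[R]_(a + a, b + b)) :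
  open U -> Ck_on c U f -> Ck_on c U (fun x => sadj (f x)).
Proof.
move=> oU; apply: (@Ck_on_linear_comp _ _ _ _ _ _ (@sadj R a b)) => //.
exact: mx_linear_continuous.
Qed.

Lemma Ck_on_gram (V : normedModType R) c (U : set V) (f : V -> 'M[R]_(l + l, k + k)) :
  open U -> Ck_on c U f -> Ck_on c U (fun x => gram (f x)).
Proof.
move=> oU cf; apply: Ck_on_add => //; first exact: Ck_on_cst.
by apply: Ck_on_mul => //; exact: Ck_on_sadj.
Qed.

Lemma Ck_on_graph_proj (V : normedModType R) c (U : set V)
    (f : V -> 'M[R]_(l + l, k + k)) :
  open U -> (forall x, U x -> gram (f x) \in unitmx) ->
  Ck_on c U f -> Ck_on c U (fun x => graph_proj (f x)).
Proof.
move=> oU fu cf.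
have cg : Ck_on c U (fun x => graph (f x)).
  apply: Ck_on_add => //; first exact: Ck_on_cst.
  by apply: Ck_on_mul => //; exact: Ck_on_cst.
apply: Ck_on_mul => //; last exact: Ck_on_sadj.
by apply: Ck_on_mul => //; apply: Ck_on_inv => //; exact: Ck_on_gram.
Qed.

Lemma gr_chart_ambient g : Sp R n g -> is_ambient_chart (SpGr R n k) (gr_chart g).
Proof.
move=> Sg; have Sg' := Sp_sadj Sg.
have cQ (c : nat) (U : set 'M[R]_(n + n)) : open U ->
    Ck_on c U (fun P => sadj g *m P *m g).
  move=> oU; apply: Ck_on_mul => //; last exact: Ck_on_cst.
  by apply: Ck_on_mul => //; [exact: Ck_on_cst | exact: Ck_on_id].
have cs (c : nat) (U : set 'rV[R]_(4 * l * k)) : open U -> Ck_on c U slope_of.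
  by move=> oU; exact: (@Ck_on_linear R _ _ _ c _ slope_of oU).
have oD : open (amb_dom (gr_chart g)).
  apply: (@open_unitmx R _ _ (fun P => corner (sadj g *m P *m g))) => P.
  have c0 := @Ck_on_corner _ 0%N _ _ openT (cQ 0%N _ openT).
  exact: (Ck_on_continuous c0).
have oC : open (amb_cod (gr_chart g)).
  apply: (@open_unitmx R _ _ (fun v => gram (slope_of v))) => v.
  have c0 := @Ck_on_gram _ 0%N _ _ openT (cs 0%N _ openT).
  exact: (Ck_on_continuous c0).
split=> //.
- move=> c; apply: (@Ck_on_linear_comp _ _ _ _ _ _ slope_coord) => //.
    exact: mx_linear_continuous.
  by apply: Ck_on_slope => //; exact: cQ.
- move=> c; apply: Ck_on_mul => //; last exact: Ck_on_cst.
  apply: Ck_on_mul => //; first exact: Ck_on_cst.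
  by apply: Ck_on_graph_proj => //; exact: cs.
- move=> P GP /= uP.
  have GQ : SpGr R n k (sadj g *m P *m g).
    by have := SpGr_act Sg' GP; rewrite sadjK.
  rewrite slope_coordK; have [ug ->] := graph_proj_slope GQ uP; split=> //.
  have gg := Sp_mulr Sg; move: (sadj g) gg => h gh.
  by rewrite !mulmxA gh mul1mx -mulmxA gh mulmx1.
- move=> v /= uv; have GP := graph_proj_SpGr uv.
  have gK : sadj g *m (g *m graph_proj (slope_of v) *m sadj g) *m g =
            graph_proj (slope_of v).
    have gg : sadj g *m g = 1%:M := Sg.
    move: (sadj g) (graph_proj _) gg => h G hg.
    by rewrite !mulmxA hg mul1mx -mulmxA hg mulmx1.
  rewrite gK slope_graph_proj// slope_ofK corner_graph_proj unitmx_inv.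
  by split=> //; exact: SpGr_act.
Qed.

Lemma corner_base : corner (base R k l) = 1%:M.
Proof. by rewrite /corner /base (mulmxA (sadj E) E) incl1K mul1mx incl1K. Qed.

Lemma base_SpGr : SpGr R n k (base R k l).
Proof.
rewrite /base; have EE := incl1K R k l; split.
- by move: (sadj E) EE => D DE; rewrite mulmxA -(mulmxA E D) DE mulmx1.
- by rewrite frame_rank// mul2n addnn.
- by rewrite (sadjM E) sadjK.
Qed.

Lemma gr_chart_cover g : Sp R n g ->
  amb_dom (gr_chart g) (g *m base R k l *m sadj g).
Proof.
move=> Sg; rewrite /=.
have -> : sadj g *m (g *m base R k l *m sadj g) *m g = base R k l.
  have gg : sadj g *m g = 1%:M := Sg.
  move: (sadj g) (base _ _ _) gg => h G hg.
  by rewrite !mulmxA hg mul1mx -mulmxA hg mulmx1.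
by rewrite corner_base unitmx1.
Qed.

End GraphCharts.

(** * The orbit map and the quotient *)

Section OrbitMap.
Local Open Scope quotient_scope.
Variables (R : realType) (k l : nat).
Local Notation n := (k + l)%N.
Local Notation e := (erefl n).
Local Notation X := (SpGr R n k).
Local Notation G := (Sp R n).
Local Notation Q := (SpQuot R e).
Local Notation pi := (SpQuot_pi R e).

Lemma mx_bounded_closed_compact p q (A : set 'M[R]_(p, q)) C :
  (forall M, A M -> `|M| <= C) -> closed A -> compact A.
Proof.
move=> AC cA.
have -> : A = vec_mx @` (vec_mx @^-1` A).
  apply/seteqP; split=> [M AM|_ [v Av <-]//].
  by exists (mxvec M); rewrite /= ?mxvecK.
have vc : continuous (vec_mx : 'rV[R]_(p * q) -> 'M[R]_(p, q)).
  exact: (@mx_linear_continuous R _ _ _ vec_mx).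
apply: continuous_compact; first exact: continuous_subspaceT.
apply: bounded_closed_compact; last first.
  by apply: closed_comp => // v _; exact: vc.
exists C; split; first exact: num_real.
move=> x Cx v Av; apply: le_trans (ltW Cx); rewrite -[v]vec_mxK.
apply: mx_norm_le => [|i j].
  by rewrite (le_trans (normr_ge0 _) (AC _ Av)).
rewrite ord1; case/mxvec_indexP: j => a b; rewrite mxvecE.
by rewrite (le_trans (mx_norm_entry _ _ _))//; exact: AC.
Qed.

Definition base_point : X := exist _ (base R k l) (mem_set (base_SpGr R k l)).

Definition orbit_map (M : G) : X := sp_action (M, base_point).

Lemma orbit_mapE M : set_val (orbit_map M) =
  set_val M *m base R k l *m sadj (set_val M).
Proof. by []. Qed.

Lemma orbit_ambient_continuous :
  continuous (fun M : 'M[R]_(n + n) => M *m base R k l *m sadj M).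
Proof.
move=> M.
have c1 : {for M, continuous (fun M : 'M[R]_(n + n) => M *m base R k l)}.
  by apply: mulmx_continuous; [exact: cvg_id | exact: cst_continuous].
have c2 : {for M, continuous (@sadj R n n)}.
  exact: (@mx_linear_continuous R _ _ _ (@sadj R n n)).
exact: (mulmx_continuous c1 c2).
Qed.

Lemma orbit_map_continuous : continuous orbit_map.
Proof.
move=> M; apply: continuous_at_subtype.
apply: (@continuous_comp _ _ _ set_val (fun M : 'M[R]_(n + n) => M *m base R k l *m sadj M)).
  exact: set_val_continuous.
exact: orbit_ambient_continuous.
Qed.

Lemma orbit_map_coset M N : orbit_map M = orbit_map N <-> sp_coset_rel e M N.
Proof.
have SM : sadj (set_val M) *m set_val M = 1%:M := set_valP M.
have SN : sadj (set_val N) *m set_val N = 1%:M := set_valP N.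
have SM' := Sp_mulr (set_valP M); have SN' := Sp_mulr (set_valP N).
split=> [MN|/asboolP [A [B [SA SB]]]].
  apply/asboolP.
  have [] := @sp_stabilizer R k l (sadj (set_val M) *m set_val N).
  - by apply: SpM; [exact/Sp_sadj/set_valP | exact: set_valP].
  - have := congr1 set_val MN; rewrite !orbit_mapE.
    move: (sadj (set_val M)) (sadj (set_val N)) (base R k l) SM SN => M' N' b M'M N'N E.
    have := congr1 (fun Z => M' *m Z *m set_val N) E.
    by rewrite !mulmxA M'M mul1mx -(mulmxA _ N') N'N mulmx1.
  - move=> A [B [SA SB E]]; exists A, B; split=> //.
    by rewrite /cast2 castmx_id.
rewrite /cast2 castmx_id => E; apply: val_inj; rewrite -!set_valE !orbit_mapE.
have c : sadj (set_val M) *m set_val N *m base R k l =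
         base R k l *m (sadj (set_val M) *m set_val N).
  by rewrite E baseE !sp_dsumM !mul1mx !mulmx1 mulmx0 mul0mx.
move: (sadj (set_val M)) (sadj (set_val N)) (base R k l) SM' SN' c => M' N' b MM' NN' c.
have := congr1 (fun Z => set_val M *m Z *m N') c.
by rewrite !mulmxA MM' mul1mx -[X in _ = X]mulmxA NN' mulmx1 => ->.
Qed.

Lemma SpQuot_piP M N : pi M = pi N <-> orbit_map M = orbit_map N.
Proof.
rewrite orbit_map_coset; split=> [/eqmodP//|MN]; exact/eqmodP.
Qed.

Definition coset_orbit (q : Q) : X := orbit_map (repr q).

Lemma coset_orbit_pi M : coset_orbit (pi M) = orbit_map M.
Proof. by apply/SpQuot_piP; rewrite /pi reprK. Qed.

Lemma coset_orbit_continuous : continuous coset_orbit.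
Proof.
apply/quotient_continuous; rewrite (_ : _ \o _ = orbit_map).
  exact: orbit_map_continuous.
by apply/funext => M; exact: coset_orbit_pi.
Qed.

Lemma orbit_map_bounded_surj (c : R) : exists C, forall P : X, `|set_val P| <= c ->
  exists2 M : G, orbit_map M = P & `|set_val M| <= C.
Proof.
have [C HC] := sp_transitive k l c; exists C => P Pc.
have [g [Sg gP gC]] := HC _ (set_valP P) Pc.
exists (exist _ g (mem_set Sg)) => //.
by apply: val_inj; rewrite -!set_valE orbit_mapE.
Qed.

Lemma orbit_map_surj P : exists M, orbit_map M = P.
Proof.
have [C HC] := orbit_map_bounded_surj `|set_val P|.
by have [M MP _] := HC P (lexx _); exists M.
Qed.

Definition orbit_coset (P : X) : Q := pi (sval (cid (orbit_map_surj P))).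

Lemma orbit_cosetE M : orbit_coset (orbit_map M) = pi M.
Proof. by rewrite /orbit_coset; case: cid => N NP; exact/SpQuot_piP. Qed.

Lemma orbit_cosetK : cancel orbit_coset coset_orbit.
Proof.
by move=> P; have [M <-] := orbit_map_surj P; rewrite orbit_cosetE coset_orbit_pi.
Qed.

Lemma coset_orbitK : cancel coset_orbit orbit_coset.
Proof.
by move=> q; rewrite -[q]reprK [\pi_ _ _]/(pi _) coset_orbit_pi orbit_cosetE.
Qed.

Lemma Sp_closed : closed (Sp R n).
Proof.
apply: (@closed_comp _ _ (fun M : 'M[R]_(n + n) => sadj M *m M) [set 1%:M]).
  move=> M _; apply: (@mulmx_continuous R _ _ _ _ (@sadj R n n) id); last exact: cvg_id.
  exact: (@mx_linear_continuous R _ _ _ (@sadj R n n)).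
exact/accessible_closed_set1/hausdorff_accessible/norm_hausdorff.
Qed.

(** For A closed in the quotient the preimage must be closed in SpGr.  Near P0
    all projections are images of symplectic matrices in a fixed ball, so the
    preimage coincides near P0 with the image of a compact set K of symplectic
    matrices with class in A, and this image is closed. *)
Lemma orbit_coset_continuous : continuous orbit_coset.
Proof.
apply/continuous_closedP => A cA.
have [B oB BA] : open (pi @^-1` (~` A)) by have := closed_openC cA.
have BA' (M : G) : B (set_val M) <-> ~ A (pi M).
  by rewrite -[B _]/((set_val @^-1` B) M) BA.
move=> P0 clP0.
have [C HC] := orbit_map_bounded_surj (`|set_val P0| + 1).
pose K := Sp R n `&` ~` B `&` [set M | `|M| <= C].
have cK : compact K.
  apply: (@mx_bounded_closed_compact _ _ _ C) => [M []//|].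
  apply: closedI; last first.
    apply: (@closed_comp _ _ (fun M : 'M[R]_(n + n) => `|M|) [set x | x <= C]).
      by move=> M _; exact: norm_continuous.
    exact: closed_le.
  by apply: closedI; [exact: Sp_closed | exact: open_closedC].
pose h (M : 'M[R]_(n + n)) := M *m base R k l *m sadj M.
have cI : closed (h @` K).
  apply: compact_closed; first exact: norm_hausdorff.
  apply: continuous_compact => //; apply: continuous_subspaceT.
  exact: orbit_ambient_continuous.
have [M [[SM nBM] _] hM] : (h @` K) (set_val P0).
  apply: cI => U UP0.
  have [|P [AP [UP bP]]] := clP0 (set_val @^-1` (U `&` ball (set_val P0) 1)).
    by apply: set_val_continuous; apply: filterI => //; exact: nbhsx_ballx.
  have [|M MP MC] := HC P.
    rewrite -[X in `|X|](subrK (set_val P0)) addrC (le_trans (ler_normD _ _))//.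
    by rewrite lerD2l -normrN opprB ltW//; move: bP; rewrite /= -ball_normE.
  exists (set_val P); split=> //; exists (set_val M); last by rewrite -MP.
  split=> //; split; first exact: set_valP.
  by move=> /BA'; rewrite -orbit_cosetE MP.
have -> : P0 = orbit_map (exist _ M (mem_set SM)).
  by apply: val_inj; rewrite -!set_valE orbit_mapE -hM.
rewrite /= orbit_cosetE; apply: contrapT => /BA'; exact: nBM.
Qed.

End OrbitMap.

(** * Atlases and the derivative of the orbit map *)

Section Submersion.
Variables (R : realType) (k l : nat).
Local Notation n := (k + l)%N.
Local Notation E := (incl1 R k l).
Local Notation F := (incl2 R k l).

(** The slope of the column space of N E. *)
Definition frame_slope (N : 'M[R]_(n + n)) := sadj F *m N *m E *m invmx (corner N).

Lemma derive_sandwich (V : normedModType R) p q (A : 'M[R]_(p, n + n))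
    (B : 'M[R]_(n + n, q)) (f : V -> 'M[R]_(n + n)) x v :
  differentiable f x ->
  differentiable (fun y => A *m f y *m B) x /\
  'D_v (fun y => A *m f y *m B) x = A *m 'D_v f x *m B.
Proof.
move=> df; have [d1 D1] := derive_mulmx v (differentiable_cst A x) df.
have [d2 D2] := derive_mulmx v d1 (differentiable_cst B x); split=> //.
by rewrite D2 D1 !derive_cst mulmx0 mul0mx add0r addr0.
Qed.

Lemma derive_frame_slope (V : normedModType R) (f : V -> 'M[R]_(n + n)) x v :
  differentiable f x -> corner (f x) \in unitmx ->
  differentiable (fun y => frame_slope (f y)) x /\
  'D_v (fun y => frame_slope (f y)) x =
  sadj F *m 'D_v f x *m E *m invmx (corner (f x)) -
  frame_slope (f x) *m corner ('D_v f x) *m invmx (corner (f x)).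
Proof.
move=> df u.
have [da Da] := derive_sandwich (sadj E) E v df.
have [db Db] := derive_sandwich (sadj F) E v df.
have [di Di] := derive_invmx v da u.
have [dd Dd] := derive_mulmx v db di; split; first exact: dd.
apply: (etrans Dd); rewrite Di Db Da [LHS]addrC mulmxN; congr (_ - _).
rewrite /frame_slope /corner; move: (invmx _) => I.
by move: (sadj E) (sadj F) => D D'; rewrite !mulmxA.
Qed.

(** The derivative of N |-> b a^-1 at N in the direction N X, with X E = F A, is
    (d - b a^-1 c) A a^-1, where a = E^+ N E, b = F^+ N E, c = E^+ N F and
    d = F^+ N F.  The Schur complement S = d - b a^-1 c is invertible because N
    is. *)
Lemma frame_slope_surj (N : 'M[R]_(n + n)) T : Sp R n N -> corner N \in unitmx ->
  exists2 X, sadj X = - X &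
    sadj F *m (N *m X) *m E *m invmx (corner N) -
    frame_slope N *m corner (N *m X) *m invmx (corner N) = T.
Proof.
move=> SN u.
pose L : 'M[R]_(l + l, n + n) := sadj F - frame_slope N *m sadj E.
pose S := L *m N *m F.
(* L = F^+ - b a^-1 E^+ annihilates N E, so L N = S F^+; multiplying by N^-1 F
   on the right gives S (F^+ N^-1 F) = L F = 1. *)
have LNE : L *m N *m E = 0.
  rewrite !mulmxBl /frame_slope -/(corner N).
  have -> : sadj F *m N *m E *m invmx (corner N) *m sadj E *m N *m E =
            sadj F *m N *m E *m invmx (corner N) *m corner N.
    by rewrite /corner; move: (sadj E) (sadj F) (invmx _) => D D' I; rewrite !mulmxA.
  by rewrite mulmxKV// subrr.
have uS : S \in unitmx.
  have SF : S *m (sadj F *m sadj N *m F) = 1%:M.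
    have -> : S *m (sadj F *m sadj N *m F) = L *m N *m (F *m sadj F) *m sadj N *m F.
      by rewrite /S; move: (sadj F) (sadj N) => D N'; rewrite !mulmxA.
    have -> : F *m sadj F = 1%:M - E *m sadj E.
      by rewrite -(incl_decomp R k l) [E *m _ + _]addrC addrK.
    rewrite mulmxBr mulmx1 (mulmxA (L *m N) E) LNE mul0mx subr0.
    rewrite -(mulmxA L N) Sp_mulr// mulmx1 mulmxBl incl2K.
    by rewrite -(mulmxA (frame_slope N)) incl12 mulmx0 subr0.
  by have [] := mulmx1_unit SF.
pose A := invmx S *m T *m corner N.
(* The Hamiltonian matrix with X E = F A and vanishing diagonal blocks. *)
pose X := F *m A *m sadj E - E *m sadj A *m sadj F.
have XE : X *m E = F *m A.
  by rewrite mulmxBl -(mulmxA (F *m A)) -(mulmxA (E *m sadj A)) incl1K incl21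
             mulmx1 mulmx0 subr0.
exists X.
  rewrite linearB /= (sadjM (F *m A)) (sadjM F) (sadjM (E *m sadj A)) (sadjM E).
  by rewrite !sadjK opprB !mulmxA.
clearbody X.
have -> : sadj F *m (N *m X) *m E = sadj F *m N *m (F *m A).
  by rewrite -XE; move: (sadj F) => D; rewrite !mulmxA.
have -> : corner (N *m X) = sadj E *m N *m (F *m A).
  by rewrite /corner -XE; move: (sadj E) => D; rewrite !mulmxA.
rewrite -mulmxBl.
have -> : sadj F *m N *m (F *m A) - frame_slope N *m (sadj E *m N *m (F *m A)) = S *m A.
  rewrite /S /L; clearbody A.
  move: (sadj F) (sadj E) (frame_slope N) => D D' s.
  by rewrite !mulmxBl !mulmxA.
by rewrite /A -(mulmxA (invmx S)) mulKVmx// mulmxK.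
Qed.

End Submersion.

Section Atlases.
Variables (R : realType) (k l : nat).
Local Notation n := (k + l)%N.
Local Notation e := (erefl n).
Local Notation X := (SpGr R n k).
Local Notation G := (Sp R n).
Local Notation Q := (SpQuot R e).
Local Notation pi := (SpQuot_pi R e).

Definition sp_one : G := exist _ 1%:M (mem_set (Sp1 R n)).

Definition sp_atlas := @induced_chart _ _ _ _ sp_one _ @` (@sp_chart R n @` Sp R n).
Definition gr_atlas := @induced_chart _ _ _ _ (base_point R k l) _ @` (@gr_chart R k l @` Sp R n).
Definition quot_atlas := pullback_chart (@coset_orbit R k l) (@orbit_coset R k l) @` gr_atlas.

Lemma sp_atlas_embedded : embedded_submanifold sp_atlas.
Proof.
apply: induced_atlas => [_ [M SM <-]|M SM]; first exact: sp_chart_ambient.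
by exists (sp_chart M); [exists M | exact: sp_chart_cover].
Qed.

Lemma gr_atlas_embedded : embedded_submanifold gr_atlas.
Proof.
apply: induced_atlas => [_ [g Sg <-]|P GP]; first exact: gr_chart_ambient.
have [M MP] := orbit_map_surj (exist _ P (mem_set GP)).
have PE : set_val M *m base R k l *m sadj (set_val M) = P := congr1 set_val MP.
rewrite -PE.
exists (gr_chart (set_val M)); first by exists (set_val M) => //; exact: set_valP.
by apply: gr_chart_cover; exact: set_valP.
Qed.

Lemma quot_atlas_manifold : smooth_manifold quot_atlas.
Proof.
have [gm _] := gr_atlas_embedded.
apply: pullback_manifold gm.
- exact: coset_orbitK.
- exact: orbit_cosetK.
- exact: coset_orbit_continuous.
- exact: orbit_coset_continuous.
Qed.

Lemma coset_orbit_diffeo : diffeomorphism quot_atlas gr_atlas (@coset_orbit R k l).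
Proof.
have [gm _] := gr_atlas_embedded.
apply: pullback_diffeomorphism gm.
- exact: coset_orbitK.
- exact: orbit_cosetK.
- exact: coset_orbit_continuous.
- exact: orbit_coset_continuous.
Qed.

Lemma sp_action_continuous : continuous (@sp_action R n k).
Proof.
move=> p; apply: continuous_at_subtype.
have c1 : {for p, continuous (fun q : G * X => set_val q.1)}.
  apply: (@continuous_comp _ _ _ fst set_val); first exact: cvg_fst.
  exact: set_val_continuous.
have c2 : {for p, continuous (fun q : G * X => set_val q.2)}.
  apply: (@continuous_comp _ _ _ snd set_val); first exact: cvg_snd.
  exact: set_val_continuous.
have c3 : {for p, continuous (fun q : G * X => sadj (set_val q.1))}.
  apply: (@continuous_comp _ _ _ (fun q : G * X => set_val q.1) (@sadj R n n)).
    exact: c1.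
  exact: (@mx_linear_continuous R _ _ _ (@sadj R n n)).
exact: (mulmx_continuous (mulmx_continuous c1 c2) c3).
Qed.

(** The action is polynomial in the two ambient matrices. *)
Lemma sp_action_smooth : smooth_map (prod_atlas sp_atlas gr_atlas) gr_atlas (@sp_action R n k).
Proof.
split; first exact: sp_action_continuous.
move=> cc c' [_ [_ [[_ [M SM <-] <-] [_ [g Sg <-] <-] ->]]] [_ [g' Sg' <-] <-].
have aM := sp_chart_ambient SM; have ag := gr_chart_ambient Sg.
have ag' := gr_chart_ambient Sg'.
set m := \dim (hamiltonian R n); set d := (4 * l * k)%N.
pose U : set 'rV[R]_(m + d) :=
  lsubmx @^-1` amb_cod (sp_chart M) `&` rsubmx @^-1` amb_cod (gr_chart g).
pose f1 (v : 'rV[R]_(m + d)) := amb_inv (sp_chart M) (lsubmx v).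
pose f2 (v : 'rV[R]_(m + d)) := amb_inv (gr_chart g) (rsubmx v).
have [[_ oC1] _ s1 h1 _] := aM; have [[_ oC2] _ s2 h2 _] := ag.
have oU : open U.
  apply: openI; apply: open_comp => // v _.
    exact: (@mx_linear_continuous R _ _ _ (@lsubmx R 1 m d)).
  exact: (@mx_linear_continuous R _ _ _ (@rsubmx R 1 m d)).
have cf1 c : Ck_on c U f1.
  apply: (Ck_on_comp oU _ _ (s1 c)); first by move=> v [].
  exact: (@Ck_on_linear R _ _ _ c _ (@lsubmx R 1 m d) oU).
have cf2 c : Ck_on c U f2.
  apply: (Ck_on_comp oU _ _ (s2 c)); first by move=> v [].
  exact: (@Ck_on_linear R _ _ _ c _ (@rsubmx R 1 m d) oU).
apply: (@induced_local_rep_smooth _ _ _ _ _ _ _ _ _ _ _ U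
          (fun v => f1 v *m f2 v *m sadj (f1 v))) => //.
- move=> c; apply: Ck_on_mul => //; last exact: Ck_on_sadj.
  exact: Ck_on_mul.
- move=> v [v1 v2].
  by rewrite -[LHS]/(set_val _ *m set_val _ *m sadj (set_val _))
     (induced_chart_invE _ aM v1) (induced_chart_invE _ ag v2).
- move=> _ [[A P] [[/= DA DP] _] <-]; split; rewrite /= ?row_mxKl ?row_mxKr.
    by have [] := h1 _ (set_valP A) DA.
  by have [] := h2 _ (set_valP P) DP.
- move=> [A P] [/= DA DP]; rewrite row_mxKl row_mxKr.
  have [_ _ K1 _ _] := induced_chart_is_chart sp_one aM.
  have [_ _ K2 _ _] := induced_chart_is_chart (base_point R k l) ag.
  exact: (congr2 pair (K1 A DA) (K2 P DP)).
Qed.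

End Atlases.

(** * The quotient map is a submersion *)

Section QuotientSubmersion.
Variables (R : realType) (k l : nat).
Local Notation n := (k + l)%N.
Local Notation e := (erefl n).
Local Notation pi := (SpQuot_pi R e).

Lemma coset_orbit_comp_pi : @coset_orbit R k l \o pi = @orbit_map R k l.
Proof. by apply/funext => M; exact: coset_orbit_pi. Qed.

(** In a chart of Sp and a transported chart of SpGr the projection becomes the
    orbit map, near each point equal to the slope of the frame g^-1 M E, whose
    derivative is onto by frame_slope_surj. *)
Lemma SpQuot_pi_submersion : smooth_submersion (@sp_atlas R k l) (@quot_atlas R k l) pi.
Proof.
split.
  split; first exact: pi_continuous.
  move=> _ _ [_ [M SM <-] <-] [_ [_ [g Sg <-] <-] <-].
  rewrite pullback_local_domr pullback_local_repr coset_orbit_comp_pi.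
  have aM := sp_chart_ambient SM; have ag := gr_chart_ambient Sg.
  have [[_ oC] _ s1 h1 _] := aM.
  apply: (@induced_local_rep_smooth _ _ _ _ _ _ _ _ _ _ _ (amb_cod (sp_chart M))
    (fun v => amb_inv (sp_chart M) v *m base R k l *m sadj (amb_inv (sp_chart M) v))) => //.
  - move=> c; have sc := s1 c.
    apply: Ck_on_mul => //; last exact: Ck_on_sadj.
    by apply: Ck_on_mul => //; exact: Ck_on_cst.
  - by move=> v v1; rewrite orbit_mapE (induced_chart_invE _ aM v1).
  - by move=> _ [A [/= DA _] <-]; have [] := h1 _ (set_valP A) DA.
  - by have [_ _ K1 _ _] := induced_chart_is_chart (@sp_one R k l) aM.
move=> _ _ [_ [M SM <-] <-] [_ [_ [g Sg <-] <-] <-] x.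
rewrite pullback_local_domr pullback_local_repr coset_orbit_comp_pi => Dx w.
have aM := sp_chart_ambient SM; have ag := gr_chart_ambient Sg.
pose c := induced_chart (@sp_one R k l) (sp_chart M).
pose c' := induced_chart (base_point R k l) (gr_chart g).
rewrite -/c -/c' in Dx *.
have [[_ oC] _ s1 h1 h2] := aM.
pose psi := amb_inv (sp_chart M).
have [Cx ux] : amb_cod (sp_chart M) x /\ corner (sadj g *m psi x) \in unitmx.
  case: Dx => A [/= DA DgA] <-.
  have [CA AE] := h1 _ (set_valP A) DA; split=> //.
  rewrite /psi AE -orbit_corner_unit (sadjM (sadj g)) sadjK.
  suff -> : sadj g *m set_val A *m base R k l *m (sadj (set_val A) *m g) =
            sadj g *m (set_val A *m base R k l *m sadj (set_val A)) *m g by exact: DgA.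
  by move: (sadj g) (sadj (set_val A)) (base R k l) => g' A' b; rewrite !mulmxA.
have dpsi : differentiable psi x by exact: (Ck_on_differentiable (s1 1%N) Cx).
have [dN _] := derive_mulmx 0 (differentiable_cst (sadj g) x) dpsi.
have [drep _] := derive_frame_slope 0 dN ux.
pose rep v := slope_coord (frame_slope (sadj g *m psi v)).
have repE : {near x, rep =1 local_rep c c' (@orbit_map R k l)}.
  have : \forall v \near x, amb_cod (sp_chart M) v /\ corner (sadj g *m psi v) \in unitmx.
    have [dc _] := derive_sandwich (sadj (incl1 R k l)) (incl1 R k l) 0 dN.
    have un := unitmx_near (differentiable_continuous dc) ux.
    exact: (filterI (open_nbhs_nbhs (conj oC Cx)) un).
  apply: filterS => v [Cv uv].
  have SN : Sp R n (sadj g *m psi v).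
    by have [Sv _ _] := h2 _ Cv; apply: SpM => //; exact: Sp_sadj.
  rewrite /rep /frame_slope -orbit_slope//.
  rewrite -[RHS]/(slope_coord (slope
    (sadj g *m set_val (orbit_map (chart_inv c v)) *m g))).
  rewrite orbit_mapE (induced_chart_invE _ aM Cv) -/psi.
  rewrite (sadjM (sadj g)) sadjK; congr (slope_coord (slope _)).
  by move: (sadj g) (sadj (psi v)) (psi v) (base R k l) => g' A' A b; rewrite !mulmxA.
have scc : continuous (@slope_coord R k l) := @mx_linear_continuous R _ _ _ (@slope_coord R k l).
have SN : Sp R n (sadj g *m psi x).
  by have [Sv _ _] := h2 _ Cx; apply: SpM => //; exact: Sp_sadj.
have [Y hY YE] := frame_slope_surj (slope_of w) SN ux.
have [v vE] := sp_chart_velocity M Cx hY.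
have [_ DN] := derive_mulmx v (differentiable_cst (sadj g) x) dpsi.
rewrite derive_cst mul0mx addr0 /= vE mulmxA in DN.
have [_ Drep] := derive_frame_slope v dN ux.
rewrite DN in Drep; have {}Drep := etrans Drep YE.
have [drep' Drep'] := @derive_linear_comp _ _ _ _ (@slope_coord R k l) _ x v scc drep.
have [dl dlE] := near_eq_differentiable repE drep'.
exists v; rewrite dlE; apply: (etrans (esym (deriveE v drep'))).
apply: (etrans Drep'); rewrite Drep.
exact: slope_ofK.
Qed.

End QuotientSubmersion.

(** * Symplectic projections *)

Section Projections.
Variables (R : realType) (n : nat).
Implicit Types (P : 'M[R]_(n + n)) (x y v : 'cV[R]_(n + n)).

Definition col_space P : {vspace 'cV[R]_(n + n)} := limg (linfun (mulmx P)).

Lemma col_spaceP P v : reflect (exists x, v = P *m x) (v \in col_space P).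
Proof.
apply: (iffP idP) => [/memv_imgP[x _ ->]|[x ->]]; first by exists x; rewrite lfunE.
by apply/memv_imgP; exists x; rewrite ?memvf// lfunE.
Qed.

Lemma dim_col_space P : \dim (col_space P) = \rank P.
Proof.
pose C := linfun (mulmx (col_base P)) : 'Hom('cV[R]_(\rank P), 'cV[R]_(n + n)).
have -> : col_space P = limg C.
  apply/vspaceP => v; apply/col_spaceP/memv_imgP => [[x ->]|[x _ ->]].
    exists (row_base P *m x); first exact: memvf.
    by rewrite lfunE /= mulmxA mulmx_base.
  exists (pinvmx (row_base P) *m x).
  rewrite lfunE /= -[X in _ = X *m _]mulmx_base -[RHS]mulmxA (mulmxA (row_base P)).
  by rewrite mulmxVp ?mul1mx// row_base_free.
have kC : (fullv :&: lker C = 0)%VS.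
  apply/eqP; rewrite -subv0; apply/subvP => x; rewrite memv_cap memv_ker memv0 memvf.
  rewrite lfunE /= => /eqP Cx.
  by rewrite -[x]mul1mx -(mulVpmx (col_base_full P)) -mulmxA Cx mulmx0.
by rewrite (limg_dim_eq kC) dimvf; exact: muln1.
Qed.

Lemma col_space_range P : range (fun x => P *m x) = [set` col_space P].
Proof.
apply/seteqP; split=> [_ [x _ <-]|v /col_spaceP[x ->]]; last by exists x.
by apply/col_spaceP; exists x.
Qed.

Lemma omega0_nondeg v : (forall x, omega0 v x = 0) -> v = 0.
Proof.
move=> v0; have vJ : v^T *m J R n = 0.
  apply/rowP => j; have := v0 (delta_mx j 0).
  by rewrite /omega0 -colE [in X in X -> _]mxE => ->; rewrite mxE.
by apply: trmx_inj; rewrite -[v^T]mulmx1 -(JJtr R n) mulmxA vJ mul0mx trmx0.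
Qed.

Lemma omega0_sadj P v x : omega0 (P *m v) x = omega0 v (sadj P *m x).
Proof.
rewrite /omega0 /sadj trmx_mul; congr (_ _ _).
by rewrite !mulmxA -(mulmxA v^T (J R n)) JJtr mulmx1.
Qed.

Lemma mx_bilinear_eq0 p q (A : 'M[R]_(p, q)) :
  (forall (v : 'cV_p) (u : 'cV_q), (v^T *m A *m u) 0 0 = 0) -> A = 0.
Proof.
move=> A0; apply/matrixP => i j; have := A0 (delta_mx i 0) (delta_mx j 0).
by rewrite trmx_delta -rowE -colE !mxE.
Qed.

(** For an idempotent P, self-adjointness of P for omega_0 amounts to the kernel
    being the symplectic complement of the range: (1 - P)^T J P = 0 says
    J P = P^T J P, and the right-hand side is skew, so J P = P^T J. *)
Lemma SpGr_projections k : SpGr R n k =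
  [set P | exists U : {vspace 'cV[R]_(n + n)},
     [/\ symplectic_subspace U, \dim U = (2 * k)%N & symplectic_projection U P]].
Proof.
apply/seteqP; split=> P.
  move=> [PP rP sP]; exists (col_space P).
  have ker : [set x : 'cV[R]_(n + n) | P *m x = 0] = sympl_compl (col_space P).
    apply/seteqP; split=> v /= => [Pv u /col_spaceP[x ->]|Pv].
      by rewrite -[in P *m x]sP -omega0_sadj Pv /omega0 trmx0 !mul0mx mxE.
    apply: omega0_nondeg => x; rewrite omega0_sadj sP; apply: Pv.
    by apply/col_spaceP; exists x.
  split; [|by rewrite dim_col_space|by split=> //; exact: col_space_range].
  rewrite /symplectic_subspace -ker; apply/seteqP; split=> [v [/= vU Pv]|_ ->] /=.
    by move: vU => /col_spaceP[x vx]; rewrite -Pv vx mulmxA PP.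
  by split; [exact: mem0v | rewrite mulmx0].
move=> [U [_ dU [PP rU kU]]].
have UE : U = col_space P.
  apply/vspaceP => v; have E : [set` U] = [set` col_space P].
    by rewrite -rU col_space_range.
  by apply/idP/idP => Uv; [have : [set` U] v by []; rewrite E
                          |have : [set` col_space P] v by []; rewrite -E].
split=> //; first by rewrite -dim_col_space -UE.
apply: sadj_fixI.
have E : (1%:M - P)^T *m J R n *m P = 0.
  apply: mx_bilinear_eq0 => v u.
  have : [set x : 'cV[R]_(n + n) | P *m x = 0] ((1%:M - P) *m v).
    by rewrite /= mulmxA mulmxBr mulmx1 PP subrr mul0mx.
  rewrite kU => /(_ (P *m u)); rewrite /omega0 trmx_mul !mulmxA; apply.
  by rewrite UE; apply/col_spaceP; exists u.
have {}E : J R n *m P = P^T *m J R n *m P.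
  by apply/eqP; rewrite -subr_eq0 -mulmxBl -{1}[J R n]mul1mx -mulmxBl -trmx1 -linearB E.
have := congr1 trmx E; rewrite !trmx_mul trmxK JtrE !(mulNmx, mulmxN) => /oppr_inj.
by rewrite mulmxA -E.
Qed.

End Projections.

(** * The symplectic Grassmann manifold *)

(** Stated for n given as a sum by an equation e, so that e can be eliminated. *)
Lemma SpGr_manifold (R : realType) (k l n : nat) (e : (k + l)%N = n) :
  exists (dG dQ : nat)
    (AG : set (chart R (Sp R n) dG))
    (AQ : set (chart R (SpQuot R e) dQ))
    (AX : set (chart R (SpGr R n k) (4 * l * k))),
  [/\ embedded_submanifold AG,
      smooth_manifold AQ /\ smooth_submersion AG AQ (SpQuot_pi R e),
      smooth_manifold AX /\ smooth_map (prod_atlas AG AX) AX (@sp_action R n k) &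
      exists F : SpQuot R e -> SpGr R n k,
        (forall M : Sp R n,
           set_val (F (SpQuot_pi R e M)) =
           set_val M *m SpGr_base R e *m sadj (set_val M)) /\
        diffeomorphism AQ AX F].
Proof.
case: n / e; exists (\dim (hamiltonian R (k + l))), (4 * l * k)%N.
exists (@sp_atlas R k l), (@quot_atlas R k l), (@gr_atlas R k l); split.
- exact: sp_atlas_embedded.
- by split; [exact: quot_atlas_manifold | exact: SpQuot_pi_submersion].
- by have [gm _] := gr_atlas_embedded R k l; split=> //; exact: sp_action_smooth.
- exists (@coset_orbit R k l); split; last exact: coset_orbit_diffeo.
  by move=> M; rewrite coset_orbit_pi orbit_mapE /SpGr_base /cast2 castmx_id baseE.
Qed.

Theorem proposition4p1 (R : realType) (n k : nat)
    (k_gt0 : (0 < k)%N) (le_kn : (k <= n)%N) :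
  SpGr R n k =
    [set P | exists U : {vspace 'cV[R]_(n + n)},
       [/\ symplectic_subspace U, \dim U = (2 * k)%N &
           symplectic_projection U P]] /\
  exists (dG dQ : nat)
    (AG : set (chart R (Sp R n) dG))
    (AQ : set (chart R (SpQuot R (subnKC le_kn)) dQ))
    (AX : set (chart R (SpGr R n k) (4 * (n - k) * k))),
  [/\ embedded_submanifold AG,
      smooth_manifold AQ /\ smooth_submersion AG AQ (SpQuot_pi R (subnKC le_kn)),
      smooth_manifold AX /\ smooth_map (prod_atlas AG AX) AX (@sp_action R n k) &
      exists F : SpQuot R (subnKC le_kn) -> SpGr R n k,
        (forall M : Sp R n,
           set_val (F (SpQuot_pi R (subnKC le_kn) M)) =
           set_val M *m SpGr_base R (subnKC le_kn) *m sadj (set_val M)) /\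
        diffeomorphism AQ AX F].
Proof.
by split; [exact: SpGr_projections | exact: SpGr_manifold].
Qed.
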